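(* Let $\varepsilon>0$ be a constant and let $q=q(n)$. Consider a random jigsaw puzzle on an $n\times n$ grid coloured with $q$ colours, as described in the context. (a) If $q=o(n)$, then the probability that the puzzle has a unique valid reconstruction up to rotation of the whole grid tends to $0$ as $n\to\infty$; i.e. with probability $1-o(1)$ there exists a valid reconstruction $H$ with $E_H\neq E_G$. (b) If $q\ge n^{1+\varepsilon}$, then the probability that the puzzle has a unique valid reconstruction up to rotation of the whole grid tends to $1$ as $n\to\infty$; i.e. with probability $1-o(1)$ every valid reconstruction $H$ satisfies $E_H=E_G$ (it coincides with the original arrangement up to a rotation of the whole grid).
   Context: The puzzle consists of $n^2$ distinguishable square pieces $v_{i,j}$, originally arranged in an $n\times n$ grid $G$ with $v_{i,j}$ at position $(i,j)$. Each piece has four sides called half-edges (top, right, bottom, left). Two half-edges of pieces adjacent in the original grid that touch form an edge of $G$ (and are called partners); each half-edge on the outer border of the grid forms an edge by itself. Let $E_G$ be this set of edges. Let $Q$ be a set of $q$ colours; the colouring $g:E_G\to Q$ assigns to each edge independently a uniformly random colour, and each half-edge inherits the colour of the edge of $E_G$ containing it. A reconstruction $H=G(\phi,\Pi)$ is given by a bijection $\phi$ of the set of $n\times n$ grid positions (placing piece $v_{i,j}$ at position $\phi(i,j)$) together with an assignment $\Pi$ of a rotation (a cyclic shift of its four sides, i.e. a rotation by a multiple of $90^\circ$; flips are not allowed) to each piece. In $H$, touching half-edges of adjacent placed pieces form an edge and border half-edges form edges by themselves; $E_H$ denotes this set of edges (as sets of half-edges). $H$ is valid if every edge of $E_H$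 is monochromatic, i.e. any two half-edges forming an edge of $H$ have the same colour. The original arrangement is always valid; the puzzle has a unique reconstruction (up to rotation of the whole grid) if every valid reconstruction $H$ has $E_H=E_G$. *)

(* Defs.v *)
From HB Require Import structures.
From mathcomp Require Import all_boot all_order all_algebra all_fingroup.
From mathcomp Require Import all_classical all_reals all_analysis.
Set Implicit Arguments.
Unset Strict Implicit.
Unset Printing Implicit Defensive.
Import Order.TTheory GRing.Theory Num.Theory.
Import numFieldNormedType.Exports.

Local Open Scope ring_scope.

(* A pair (i, j) is (row, column), rows being numbered downwards.  It names
   both a position of the grid and the piece v_(i,j) originally placed there. *)
Definition cell (n : nat) : finType := ('I_n * 'I_n)%type.

(* Sides are elements of Z/4, numbered clockwise, so that a clockwise rotation by
   r quarter turns moves side k to side k + r. *)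
Definition top_side : 'Z_4 := 0.
Definition right_side : 'Z_4 := 1.
Definition bottom_side : 'Z_4 := 2.
Definition left_side : 'Z_4 := 3.

(* A cell together with one of its sides: either a half-edge of a piece, or the
   place in the grid where such a half-edge can be put (see [place]). *)
Definition half_edge (n : nat) : finType := (cell n * 'Z_4)%type.

Definition faces (n : nat) (s t : half_edge n) : bool :=
  [&& s.2 == right_side, t.2 == left_side,
      s.1.1 == t.1.1 & (t.1.2 : nat) == (s.1.2 : nat).+1]
  || [&& s.2 == bottom_side, t.2 == top_side,
      s.1.2 == t.1.2 & (t.1.1 : nat) == (s.1.1 : nat).+1].

Definition touch (n : nat) (s t : half_edge n) : bool := faces s t || faces t s.

Record reconstruction (n : nat) := Reconstruction {
  position : {perm cell n};
  rotation : {ffun cell n -> 'Z_4}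
}.

Definition original (n : nat) : reconstruction n :=
  Reconstruction 1%g [ffun=> 0].

Definition place (n : nat) (H : reconstruction n) (h : half_edge n) :
    half_edge n :=
  (position H h.1, h.2 + rotation H h.1).

(* The edge of H containing the half-edge h; it is the singleton of h when h is
   placed on the border of the grid. *)
Definition edge_of (n : nat) (H : reconstruction n) (h : half_edge n) :
    {set half_edge n} :=
  [set h' | (h' == h) || touch (place H h) (place H h')].

Definition edges (n : nat) (H : reconstruction n) : {set {set half_edge n}} :=
  [set edge_of H h | h in [set: half_edge n]].

Lemma edge_of_edges (n : nat) (H : reconstruction n) (h : half_edge n) :
  edge_of H h \in edges H.
Proof. by apply: imset_f; rewrite inE. Qed.

Definition original_edge (n : nat) : finType :=
  {e : {set half_edge n} | e \in edges (original n)}.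

Definition colouring (n q : nat) : finType := {ffun original_edge n -> 'I_q}.

Definition colour (n q : nat) (g : colouring n q) (h : half_edge n) : 'I_q :=
  g (exist _ (edge_of (original n) h) (edge_of_edges (original n) h)).

Definition valid (n q : nat) (g : colouring n q) (H : reconstruction n) : Prop :=
  forall e : {set half_edge n}, e \in edges H ->
    {in e &, forall h h', colour g h = colour g h'}.

Definition unique_reconstruction (n q : nat) (g : colouring n q) : Prop :=
  forall H : reconstruction n, valid g H -> edges H = edges (original n).

(* Product of the uniform distributions on the q colours, one factor for each
   edge of the original grid. *)
Definition prob (R : realType) (n q : nat) (A : colouring n q -> Prop) : R :=
  \sum_(g : colouring n q | `[< A g >])
    \prod_(e : original_edge n) (q%:R^-1 : R).

(* Main.v *)
(** (a) A piece whose opposite sides agree in colour may be rotated by a half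
    turn.  Scanning the cells in row-major order, the bottom and right edges of a
    cell are fresh, so the probability that no piece is symmetric is at most
    [(1 - 1/q^2)^(n^2) <= (q/n)^2].

    (b) Write [alpha = n^(-1/m)] with [1/m <= eps], so that [1/q <= alpha/n].  A
    [k x k] window of a reconstruction is valid with probability at most [q^-r]
    when [r] of its colour constraints are independent, while there are
    [O(n^(2c))] ways to fill it using pieces that form [c] connected components of
    the original grid.  Hence with high probability every valid window of bounded
    size is "sparse": [(m+1) r <= 2 m c].  Each component has in each of the four
    directions an extremal half-edge whose partner is absent from the window, and
    such half-edges, unless on the border of the window, give independent
    constraints.  With sparsity this forces a large window to have few bad
    adjacencies on the boundary of some concentric subwindow, then boundedly many
    in that subwindow, then none on the boundary of a still smaller one; a window
    with clean boundary contains no bad adjacency at all.  So in a valid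
    reconstruction everything at bounded distance from the border is in place up
    to a rigid motion, which has boundedly many possibilities.  The remaining frame
    is filled row by row: only [O(n)] pieces are left, [O(1)] positions have one
    known neighbour (expected number of errors [O(n/q)]) and [O(n)] positions have
    two known adjacent neighbours (expected number of errors [O(n^2/q^2)]). *)
Require Import Defs.
From HB Require Import structures.
From mathcomp Require Import all_boot all_order all_algebra all_fingroup.
From mathcomp Require Import all_classical all_reals all_analysis.
(* Repeated so that finite sets take precedence over classical sets. *)
From mathcomp Require Import zify fintype finset.
Set Implicit Arguments.
Unset Strict Implicit.
Unset Printing Implicit Defensive.
Import Order.TTheory GRing.Theory Num.Theory.
Import numFieldNormedType.Exports.
Local Open Scope ring_scope.

(** * Geometry of the grid *)

(* Indexed by the sides in the order top, right, bottom, left; rows grow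
   downwards. *)
Definition row_step (d : 'Z_4) : int := nth 0 [:: -1; 0; 1; 0] d.
Definition col_step (d : 'Z_4) : int := nth 0 [:: 0; 1; 0; -1] d.

Definition row n (c : cell n) : nat := c.1.
Definition col n (c : cell n) : nat := c.2.

Lemma row_lt n (c : cell n) : (row c < n)%N. Proof. exact: ltn_ord. Qed.
Lemma col_lt n (c : cell n) : (col c < n)%N. Proof. exact: ltn_ord. Qed.

Lemma cell_eq n (c c' : cell n) : row c = row c' -> col c = col c' -> c = c'.
Proof. by case: c c' => [i j] [k l] h1 h2; congr (_, _); apply: ord_inj. Qed.

Lemma side_ind (P : 'Z_4 -> Prop) : P 0 -> P 1 -> P 2 -> P 3 -> forall d, P d.
Proof.
move=> P0 P1 P2 P3 [[|[|[|[|//]]]] lt_i4].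
- by rewrite (_ : Ordinal _ = 0) //; apply: val_inj.
- by rewrite (_ : Ordinal _ = 1) //; apply: val_inj.
- by rewrite (_ : Ordinal _ = 2) //; apply: val_inj.
by rewrite (_ : Ordinal _ = 3) //; apply: val_inj.
Qed.

Lemma touchE n (x y : half_edge n) :
  touch x y = [&& y.2 == x.2 + 2,
    (row y.1)%:Z == (row x.1)%:Z + row_step x.2 &
    (col y.1)%:Z == (col x.1)%:Z + col_step x.2].
Proof.
case: x y => [[i j] d] [[k l] e]; rewrite /touch /faces /row /col /=.
rewrite -!(inj_eq (@ord_inj n)).
by elim/side_ind: d; elim/side_ind: e;
  rewrite /row_step /col_step /top_side /right_side /bottom_side /left_side /=; lia.
Qed.

Lemma touch_sym n (x y : half_edge n) : touch x y = touch y x.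
Proof. by rewrite /touch orbC. Qed.

Lemma touch_side n (x y : half_edge n) : touch x y -> y.2 = x.2 + 2.
Proof. by rewrite touchE => /and3P[/eqP]. Qed.

Lemma touch_inj n (x y z : half_edge n) : touch x y -> touch x z -> y = z.
Proof.
rewrite !touchE => /and3P[/eqP y2 /eqP y11 /eqP y12] /and3P[/eqP z2 /eqP z11 /eqP z12].
case: y z y2 y11 y12 z2 z11 z12 => [c d] [c' e] /= -> Hi Hj -> Hk Hl.
by congr (_, _); apply: cell_eq; lia.
Qed.

Lemma touch_cell_neq n (x y : half_edge n) : touch x y -> x.1 != y.1.
Proof.
rewrite touchE => /and3P[_ y11 y12]; apply/eqP => e; move: y11 y12; rewrite e.
by elim/side_ind: (x.2); rewrite /row_step /col_step /=; lia.
Qed.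

Lemma touch_irr n (x : half_edge n) : touch x x = false.
Proof. by apply/negP => /touch_cell_neq; rewrite eqxx. Qed.

Lemma neighbour_exists n (c : cell n) (d : 'Z_4) :
  0 <= (row c)%:Z + row_step d < n%:Z ->
  0 <= (col c)%:Z + col_step d < n%:Z ->
  exists c' : cell n, touch (c, d) (c', d + 2).
Proof.
move=> h1 h2.
have l1 : (absz ((row c)%:Z + row_step d)%R < n)%N by lia.
have l2 : (absz ((col c)%:Z + col_step d)%R < n)%N by lia.
by exists (Ordinal l1, Ordinal l2); rewrite touchE /row /col /= eqxx !gez0_abs ?eqxx //;
  [case/andP: h2 | case/andP: h1].
Qed.

(** The linear form [score] grows by one at each step in direction [d], so a maximiser over [U] has
    no neighbour in [U] on that side. *)
Lemma extremal_cell n (U : {set cell n}) (c0 : cell n) (d : 'Z_4) : c0 \in U ->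
  exists2 c, c \in U & forall y, touch (c, d) y -> y.1 \notin U.
Proof.
move=> c0U.
pose score (c : cell n) : int :=
  (row c)%:Z * row_step d + (col c)%:Z * col_step d.
case: (@Order.TotalTheory.arg_maxP _ _ _ c0 (mem U) score c0U) => c cU cmax.
exists c => // y; rewrite touchE => /and3P[_ /eqP /= y1 /eqP y2].
apply/negP => /cmax; rewrite /score y1 y2.
by elim/side_ind: d {score cmax y1 y2}; rewrite /row_step /col_step /=; lia.
Qed.

(** Spelled as in [colour], so that [colour g x] is [g (edge_id x)] by computation. *)
Definition edge_id n (x : half_edge n) : original_edge n :=
  exist _ (edge_of (original n) x) (edge_of_edges (original n) x).

Lemma place_original n (x : half_edge n) : place (original n) x = x.
Proof. by case: x => c d; rewrite /place /= perm1 ffunE addr0. Qed.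

Lemma edge_id_eq n (x y : half_edge n) :
  (edge_id x == edge_id y) = (x == y) || touch x y.
Proof.
rewrite -val_eqE /=; apply/eqP/orP => [/setP/(_ x)|].
  rewrite !inE eqxx !place_original touch_irr /= => /esym/orP[/eqP->|]; first by left.
  by right; rewrite touch_sym.
case=> [/eqP->//|xy]; apply/setP => z; rewrite !inE !place_original.
apply/orP/orP => -[/eqP->|xz].
- by right; rewrite touch_sym.
- by left; rewrite (touch_inj xy xz).
- by right.
by left; apply/eqP; apply: (touch_inj xz); rewrite touch_sym.
Qed.

Lemma touch_colour n q (g : colouring n q) (x y : half_edge n) :
  touch x y -> colour g x = colour g y.
Proof. by move=> xy; congr (g _); apply/eqP; rewrite edge_id_eq xy orbT. Qed.

(** * Counting colourings *)

(* The first component of each pair occurs nowhere later in the list, so each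
   equation [g p.1 = g p.2] divides the number of functions [g] by [q]. *)
Fixpoint triangular (E : eqType) (s : seq (E * E)) : bool :=
  if s is p :: s' then
    [&& p.1 != p.2, p.1 \notin unzip1 s', p.1 \notin unzip2 s' & triangular s']
  else true.

(** Overwriting the value at [a] maps pairs of a member of [P] and a colour into [Q], injectively:
    the lost value [g a] is [f g], which depends only on the other values. *)
Lemma card_update (E : finType) (q : nat) (P Q : pred {ffun E -> 'I_q})
    (a : E) (f : {ffun E -> 'I_q} -> 'I_q) :
  (forall g h : {ffun E -> 'I_q}, (forall e, e != a -> g e = h e) -> f g = f h) ->
  (forall g, P g -> g a = f g) ->
  (forall g h : {ffun E -> 'I_q}, (forall e, e != a -> g e = h e) -> P g -> Q h) ->
  (#|P| * q <= #|Q|)%N.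
Proof.
move=> fa Pf PQ.
pose upd (p : {ffun E -> 'I_q} * 'I_q) := [ffun e => if e == a then p.2 else p.1 e].
have updE p e : e != a -> upd p e = p.1 e by rewrite ffunE => /negPf->.
have <- : #|[predX P & predT : {pred 'I_q}]| = (#|P| * q)%N.
  by rewrite cardX (eq_card (B := 'I_q)) ?card_ord //.
rewrite -(card_in_image (f := upd)); last first.
  move=> [g1 v1] [g2 v2] /andP[/= P1 _] /andP[/= P2 _] eq12.
  have eqv : v1 = v2 by move/ffunP/(_ a): eq12; rewrite !ffunE eqxx.
  have eqg e : e != a -> g1 e = g2 e.
    by move=> ea; rewrite -(updE (g1, v1)) // eq12 updE.
  congr (_, _) => //; apply/ffunP => e; have [->|ea] := eqVneq e a; last exact: eqg.
  by rewrite (Pf _ P1) (Pf _ P2); apply: fa.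
apply: subset_leq_card; apply/subsetP => h /imageP[[g v] /andP[/= Pg _] ->].
by apply: PQ Pg => e ea; rewrite updE.
Qed.

Lemma card_triangular (E : finType) (q : nat) (s : seq (E * E)) : triangular s ->
  (#|[pred g : {ffun E -> 'I_q} | all (fun p => g p.1 == g p.2) s]| * q ^ size s
    <= q ^ #|E|)%N.
Proof.
elim: s => [_|[a b] s IH /and4P[/= ab a1 a2 /IH]].
  by rewrite muln1 -[X in (_ <= X ^ _)%N](card_ord q) -card_ffun max_card.
apply: leq_trans; rewrite expnS mulnA leq_mul2r; apply/orP; right.
apply: (@card_update _ _ _ _ a (fun g => g b)) => [g h gh|g|g h gh] /=.
- by apply: gh; rewrite eq_sym.
- by case/andP => /eqP.
case/andP => _ /allP sg; apply/allP => p ps /=.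
by rewrite -!gh ?sg //; [apply: contraNneq a2 | apply: contraNneq a1] => <-; apply: map_f.
Qed.

(** * Probabilities as normalised counts *)

Section Probability.
Variables (R : realType) (n q : nat).
Hypothesis q_gt0 : (0 < q)%N.
Implicit Types A B : colouring n q -> Prop.

Lemma probE A : prob R A =
  #|[pred g | `[< A g >]]|%:R / (q ^ #|original_edge n|)%:R.
Proof.
rewrite /prob prodr_const natrX -exprVn big_const iter_addr_0 mulr_natl.
by congr (_ *+ _); apply: eq_card => g; rewrite !inE.
Qed.

Lemma prob_ge0 A : 0 <= prob R A.
Proof. by rewrite probE divr_ge0. Qed.

Lemma prob_eq0 A : (forall g, ~ A g) -> prob R A = 0.
Proof.
move=> nA; rewrite probE eq_card0 ?mul0r // => g.
by apply/negbTE/negP => /asboolP/nA.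
Qed.

Lemma le_prob A B : (forall g, A g -> B g) -> prob R A <= prob R B.
Proof.
move=> AB; rewrite !probE ler_wpM2r ?invr_ge0 // ler_nat.
by apply/subset_leq_card/subsetP => g; rewrite !inE => /asboolP Ag; apply/asboolP/AB.
Qed.

Lemma prob_setC A : prob R A = 1 - prob R (fun g => ~ A g).
Proof.
apply/eqP; rewrite eq_sym subr_eq !probE -mulrDl -natrD.
rewrite [X in (_ + X)%N](eq_card (B := predC [pred g | `[< A g >]])); last first.
  by move=> g; rewrite /in_mem /= asbool_neg.
rewrite cardC card_ffun card_ord divff //.
by rewrite pnatr_eq0 -lt0n expn_gt0 q_gt0.
Qed.

Lemma prob_le1 A : prob R A <= 1.
Proof. by rewrite prob_setC gerBl prob_ge0. Qed.

Lemma prob_exists (I : finType) (S : pred I) (A : I -> colouring n q -> Prop) :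
  prob R (fun g => exists2 i, S i & A i g) <= \sum_(i | S i) prob R (A i).
Proof.
under [leRHS]eq_bigr do rewrite probE.
rewrite probE -mulr_suml ler_wpM2r ?invr_ge0 // -natr_sum ler_nat.
rewrite -sum1_card; under [leqRHS]eq_bigr do rewrite -sum1_card big_mkcond.
rewrite exchange_big /= big_mkcond leq_sum // => g _; case: ifP => //.
rewrite inE => /asboolP[i Si Ai]; rewrite (bigD1 i) //= inE.
by rewrite asboolT //; apply: leq_addr.
Qed.

Lemma prob_or A B : prob R (fun g => A g \/ B g) <= prob R A + prob R B.
Proof.
rewrite !probE -mulrDl ler_wpM2r ?invr_ge0 // -natrD ler_nat.
rewrite -cardUI; apply: leq_trans (leq_addr _ _).
apply/subset_leq_card/subsetP => g; rewrite !inE => /asboolP[] h;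
  apply/orP; [left|right]; exact/asboolP.
Qed.

Lemma prob_triangular (s : seq (half_edge n * half_edge n)) :
  triangular [seq (edge_id p.1, edge_id p.2) | p <- s] ->
  prob R (fun g : colouring n q => forall p, p \in s -> colour g p.1 = colour g p.2)
    <= q%:R^-1 ^+ size s.
Proof.
move=> /(@card_triangular _ q); rewrite size_map => le_q.
rewrite probE exprVn -natrX ler_pdivrMr ?ltr0n ?expn_gt0 ?q_gt0 //.
rewrite mulrC ler_pdivlMr ?ltr0n ?expn_gt0 ?q_gt0 // -natrM ler_nat.
apply: leq_trans le_q; rewrite leq_mul2r; apply/orP; right.
apply/subset_leq_card/subsetP => g; rewrite !inE => /asboolP h.
by rewrite all_map; apply/allP => p /h /= hp; apply/eqP.
Qed.

End Probability.

(** * Few colours: symmetric pieces *)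

Definition symmetric_piece n q (g : colouring n q) (c : cell n) : bool :=
  (colour g (c, 0) == colour g (c, 2)) && (colour g (c, 1) == colour g (c, 3)).

(** A half turn of [c] preserves every colour but changes the partner of a half-edge of some
    neighbour, which exists as [1 < n]. *)
Lemma symmetric_not_unique n q (g : colouring n q) (c : cell n) : (1 < n)%N ->
  symmetric_piece g c -> ~ unique_reconstruction g.
Proof.
move=> n_gt1 /andP[/eqP c02 /eqP c13].
pose H := Reconstruction 1%g [ffun c' => if c' == c then 2 else 0 : 'Z_4].
have placeH h : place H h = (h.1, if h.1 == c then h.2 + 2 else h.2).
  by case: h => c' d; rewrite /place /= perm1 ffunE; case: eqP; rewrite ?addr0.
have colourH h : colour g (place H h) = colour g h.
  rewrite placeH; case: h => c' d /=; case: eqP => // ->.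
  have t31 : (1 + 2 : 'Z_4) = 3 by apply: val_inj.
  have t20 : (2 + 2 : 'Z_4) = 0 by apply: val_inj.
  have t13 : (3 + 2 : 'Z_4) = 1 by apply: val_inj.
  by elim/side_ind: d; rewrite ?add0r ?t31 ?t20 ?t13 ?c02 ?c13.
have validH : valid g H.
  move=> e /imsetP[h _ ->].
  have heq h' : h' \in edge_of H h -> colour g h' = colour g h.
    rewrite inE => /orP[/eqP->//|/touch_colour ct].
    by rewrite -colourH -ct colourH.
  by move=> h1 h2 /heq-> /heq->.
move=> /(_ H validH) eqHG.
have [d [y cy]] : exists d y, touch (c, d) y.
  have [lt_c1 lt_c2] := (row_lt c, col_lt c).
  have [le1|gt1] := leqP 1 (row c).
    have [||c' cc'] := @neighbour_exists n c 0; last by exists 0, (c', 0 + 2).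
      by rewrite /row_step /=; lia.
    by rewrite /col_step /=; lia.
  have [||c' cc'] := @neighbour_exists n c 2; last by exists 2, (c', 2 + 2).
    by rewrite /row_step /=; lia.
  by rewrite /col_step /=; lia.
have: edge_of H y \in edges (original n) by rewrite -eqHG edge_of_edges.
have yc : (y.1 == c) = false.
  by apply/negbTE; rewrite eq_sym; apply: touch_cell_neq cy.
case/imsetP => h _ /setP eH.
have yh : y \in edge_of (original n) h by rewrite -eH inE eqxx.
have ch : (c, d - 2) \in edge_of (original n) h.
  by rewrite -eH inE !placeH yc eqxx subrK -surjective_pairing touch_sym cy orbT.
(* Both half-edges lie in one original edge, while [y] also touches [(c, d)]: the side of [y] would
   be both [d] and [d + 2]. *)
have : touch y (c, d - 2).
  have ycd : y != (c, d - 2) by apply/eqP => e; rewrite e eqxx in yc.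
  move: yh ch; rewrite !inE !place_original.
  move=> /orP[/eqP <-|hy] /orP[/eqP e|hc] //.
  - by rewrite -e eqxx in ycd.
  - by rewrite e touch_sym.
  by rewrite (touch_inj hy hc) eqxx in ycd.
rewrite touch_sym => /touch_side; rewrite (touch_side cy) /= subrK => /eqP.
by elim/side_ind: d {cy ch eH}.
Qed.

(** Resetting [a] to the colour [f g] while remembering the old value [g a] is injective. *)
Lemma card_update_le (E : finType) (q : nat) (P Q : pred {ffun E -> 'I_q})
    (a : E) (f : {ffun E -> 'I_q} -> 'I_q) :
  (forall g h : {ffun E -> 'I_q}, (forall e, e != a -> g e = h e) -> h a = f g ->
     Q g -> P h) ->
  (#|Q| <= #|P| * q)%N.
Proof.
move=> QP.
pose upd (g : {ffun E -> 'I_q}) := [ffun e => if e == a then f g else g e].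
have updE g e : e != a -> upd g e = g e by rewrite ffunE => /negPf->.
have <- : #|[predX P & predT : {pred 'I_q}]| = (#|P| * q)%N.
  by rewrite cardX (eq_card (B := 'I_q)) ?card_ord //.
rewrite -(card_in_image (f := fun g => (upd g, g a))); last first.
  move=> g1 g2 _ _ [/ffunP eqg eqa]; apply/ffunP => e.
  by have [->//|ea] := eqVneq e a; rewrite -updE // eqg updE.
apply: subset_leq_card; apply/subsetP => _ /imageP[g Qg ->].
apply/andP; split=> //=; apply: QP Qg; last by rewrite ffunE eqxx.
by move=> e ea; rewrite updE.
Qed.

Definition rank n (c : cell n) : nat := (row c * n + col c)%N.

Lemma rank_inj n : injective (@rank n).
Proof.
case=> i j [k l]; rewrite /rank /row /col /= => eq_r.
have := congr1 (divn^~ n) eq_r; have := congr1 (modn^~ n) eq_r.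
have n_gt0 : (0 < n)%N by apply: leq_ltn_trans (leq0n i) (ltn_ord i).
rewrite !modnMDl !modn_small // !divnMDl // !divn_small // !addn0.
by move=> jl ik; congr (_, _); apply: ord_inj.
Qed.

Lemma rank_surj n r : (r < n ^ 2)%N -> exists c : cell n, rank c = r.
Proof.
move=> r_lt; have n_gt0 : (0 < n)%N by case: n r_lt.
have h1 : (r %/ n < n)%N by rewrite ltn_divLR // mulnn.
exists (Ordinal h1, Ordinal (ltn_pmod r n_gt0)).
by rewrite /rank /row /col /= -divn_eq.
Qed.

Lemma edge_id_rank n (c c' : cell n) (d d' : 'Z_4) : d \in [:: 1; 2] ->
  (rank c' < rank c)%N -> edge_id (c', d') != edge_id (c, d).
Proof.
move=> dP lt_r; apply/negP; rewrite edge_id_eq => /orP[/eqP[ec _]|].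
  by rewrite ec ltnn in lt_r.
rewrite touch_sym touchE /= => /and3P[_ /eqP h1 /eqP h2].
move: lt_r h1 h2; rewrite /rank; have := col_lt c'; have := col_lt c.
by move: dP; rewrite !inE => /orP[] /eqP ->; rewrite /row_step /col_step /=; nia.
Qed.

Lemma edge_id_side n (c : cell n) (d d' : 'Z_4) :
  (edge_id (c, d) == edge_id (c, d')) = (d == d').
Proof.
rewrite edge_id_eq xpair_eqE eqxx /=; case: eqP => //= _.
by apply/negP => /touch_cell_neq; rewrite eqxx.
Qed.

(* The bottom and right edges of a cell belong to no cell before it in
   row-major order, so a cell is symmetric independently of the earlier ones. *)
Lemma card_no_symmetric_piece n q r : (0 < q)%N -> (r <= n ^ 2)%N ->
  (#|[pred g : colouring n q |
       [forall c, (rank c < r)%N ==> ~~ symmetric_piece g c]]| * (q ^ 2) ^ r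
    <= q ^ #|original_edge n| * (q ^ 2 - 1) ^ r)%N.
Proof.
move=> q_gt0; elim: r => [_|r IH r_lt].
  by rewrite !muln1 -[X in (_ <= X ^ _)%N](card_ord q) -card_ffun max_card.
have {IH} IH := IH (ltnW r_lt).
pose sat r (g : colouring n q) :=
  [forall c, (rank c < r)%N ==> ~~ symmetric_piece g c].
have [c c_r] := rank_surj r_lt.
have sat_upd d (g h : colouring n q) : d \in [:: 1; 2] ->
    (forall e, e != edge_id (c, d) -> g e = h e) -> sat r g -> sat r h.
  move=> dP gh /forallP sg; apply/forallP => c'; apply/implyP => lt_c'.
  have := sg c'; rewrite lt_c' /= /symmetric_piece /colour.
  by rewrite !gh //; apply: edge_id_rank => //; rewrite c_r.
(* The right edge of [c] is recoloured to match the left one, then the bottom edge to match the top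
   one; each recolouring loses a factor of at most [q]. *)
have card_sat : (#|sat r| <= #|[pred g | sat r g & symmetric_piece g c]| * q ^ 2)%N.
  pose T := [pred g : colouring n q | sat r g & colour g (c, 1) == colour g (c, 3)].
  apply: (@leq_trans (#|T| * q)).
    apply: (@card_update_le _ _ _ _ (edge_id (c, 1)) (fun g => colour g (c, 3))).
    move=> g h gh ha sg; apply/andP; split; first by apply: sat_upd gh sg.
    by rewrite /= {1}/colour [h _]ha /colour gh //= edge_id_side.
  rewrite expnS expn1 mulnA leq_mul2r; apply/orP; right.
  apply: (@card_update_le _ _ _ _ (edge_id (c, 2)) (fun g => colour g (c, 0))).
  move=> g h gh ha /andP[sg /eqP g13]; apply/andP; split; first by apply: sat_upd gh sg.
  rewrite /= /symmetric_piece {2}/colour [h _]ha /colour -!gh ?edge_id_side //.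
  by rewrite eqxx; apply/eqP.
have split_sat : (#|sat r| =
    #|[pred g | sat r g & symmetric_piece g c]| + #|sat r.+1|)%N.
  rewrite -(cardID [pred g | symmetric_piece g c] (sat r)); congr (_ + _)%N.
  apply: eq_card => g; rewrite !inE /= /in_mem /=; apply/andP/forallP.
    case=> nc /forallP sg c'; apply/implyP; rewrite ltnS leq_eqVlt => /orP[|lt_c'].
      by rewrite -c_r => /eqP/rank_inj->.
    by have := sg c'; rewrite lt_c'.
  move=> sg; split; first by have := sg c; rewrite c_r ltnSn.
  apply/forallP => c'; apply/implyP => lt_c'; have := sg c'.
  by rewrite (leq_trans lt_c').
rewrite [in leqRHS]expnSr mulnA -/(sat r.+1).
apply: leq_trans (leq_mul IH (leqnn _)); rewrite -/(sat r).
have -> : #|[pred g : colouring n q | sat r.+1 g]| = #|sat r.+1| by [].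
have -> : #|[pred g : colouring n q | sat r g]| = #|sat r| by [].
rewrite expnS mulnA [leqRHS]mulnAC leq_mul2r; apply/orP; right.
have : (0 < q ^ 2)%N by rewrite expn_gt0 q_gt0.
by move: (q ^ 2)%N card_sat split_sat => Q; nia.
Qed.

(** With [x = q^-2], the inequality [(1 - x)(1 + x) <= 1] and Bernoulli bound [(1 - x)^(n^2)] by
    [1 / (1 + n^2 x)], hence by [1 / (n^2 x)]. *)
Lemma prob_unique_le (R : realType) n q : (0 < q)%N -> (1 < n)%N ->
  prob R (@unique_reconstruction n q) <= (q%:R / n%:R) ^+ 2.
Proof.
move=> q_gt0 n_gt1; pose x : R := q%:R^-1 ^+ 2.
pose A (g : colouring n q) := [forall c, (rank c < n ^ 2)%N ==> ~~ symmetric_piece g c].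
have x_gt0 : 0 < x by rewrite exprn_gt0 // invr_gt0 ltr0n.
have x_le1 : x <= 1 by rewrite exprn_ile1 // invf_le1 ?ltr0n // ler1n.
apply: (@le_trans _ _ (prob R (fun g : colouring n q => A g))).
  apply: le_prob => g ug; apply/forallP => c; apply/implyP => _.
  by apply/negP => /(symmetric_not_unique n_gt1)/(_ ug).
apply: (@le_trans _ _ ((1 - x) ^+ (n ^ 2))).
  have Q_gt0 : 0 < (q ^ 2)%:R :> R by rewrite ltr0n expn_gt0 q_gt0.
  have -> : 1 - x = (q ^ 2 - 1)%:R / (q ^ 2)%:R.
    rewrite natrB ?expn_gt0 ?q_gt0 // mulrBl divff ?gt_eqF //.
    by rewrite mul1r natrX /x exprVn.
  rewrite probE // expr_div_n ler_pdivrMr ?ltr0n ?expn_gt0 ?q_gt0 //.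
  rewrite mulrAC ler_pdivlMr ?exprn_gt0 // -!natrX -!natrM ler_nat.
  rewrite [leqRHS]mulnC; apply: leq_trans (card_no_symmetric_piece q_gt0 (leqnn _)).
  rewrite leq_mul2r; apply/orP; right.
  by apply/subset_leq_card/subsetP => g; rewrite !inE => /asboolP.
have n2x_gt0 : 0 < (n%:R ^+ 2 * x) :> R.
  by rewrite mulr_gt0 // exprn_gt0 // ltr0n ltnW.
have bern : 1 + (n ^ 2)%:R * x <= (1 + x) ^+ (n ^ 2).
  elim: (n ^ 2)%N => [|k IH]; first by rewrite mul0r addr0 expr0.
  rewrite exprS; apply: le_trans (ler_wpM2l _ IH); last by rewrite addr_ge0 // ltW.
  rewrite mulrDl mul1r mulrDr mulr1 -natr1 mulrDl mul1r addrA addrA.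
  by rewrite -addrA -addrA lerD2l addrC lerDl mulr_ge0 // ?mulr_ge0 // ltW.
have -> : (q%:R / n%:R) ^+ 2 = (n%:R ^+ 2 * x)^-1.
  by rewrite expr_div_n /x exprVn invf_div.
apply: (@le_trans _ _ ((1 + x) ^+ (n ^ 2))^-1).
  rewrite -[leRHS]mul1r ler_pdivlMr ?exprn_gt0 ?addr_gt0 // -exprMn.
  rewrite exprn_ile1 //; first by rewrite mulr_ge0 ?subr_ge0 // addr_ge0 // ltW.
  by rewrite -subr_sqr expr1n gerBl exprn_ge0 // ltW.
rewrite lef_pV2 ?posrE ?exprn_gt0 ?addr_gt0 //.
by apply: le_trans bern; rewrite natrX lerDr.
Qed.

(** * Patches *)

(* A filling of a k x k window of a reconstruction: the piece placed at each
   position of the window, and its rotation. *)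
Definition patch (k n : nat) : finType := {ffun cell k -> cell n * 'Z_4}.

Section Patch.
Variables (k n : nat) (sigma : patch k n).

(** The side is rotated back into the frame of the piece, inverting [place]. *)
Definition occupant (x : half_edge k) : half_edge n :=
  ((sigma x.1).1, x.2 - (sigma x.1).2).

Definition pieces_inj : Prop := injective (fun u => (sigma u).1).

Definition valid_patch q (g : colouring n q) : Prop :=
  forall x y, touch x y -> colour g (occupant x) = colour g (occupant y).

Definition has_mate (x : half_edge k) : bool := [exists y, touch x y].

Definition bad (x : half_edge k) : bool :=
  [exists y, touch x y && ~~ touch (occupant x) (occupant y)].

(** The partner of the occupant in the original grid is absent from the window, or there is none. *)
Definition exposed (x : half_edge k) : bool :=
  ~~ [exists y, touch (occupant x) (occupant y)].

Definition leaf (x : half_edge k) : bool := has_mate x && exposed x.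

(** Adjacency in the original grid, wherever the two pieces lie in the window. *)
Definition piece_adj (u v : cell k) : bool :=
  [exists d, [exists e, touch ((sigma u).1, d) ((sigma v).1, e)]].

Definition comp_of (u : cell k) : cell k := fingraph.root piece_adj u.

Definition ncomp : nat := #|[set u | comp_of u == u]|.

(** The window imposes [r] colour equations in triangular form over the original edges, so it is
    valid with probability at most [q^-r]. *)
Definition independent (r : nat) : Prop := exists s : seq (half_edge k * half_edge k),
  [/\ size s = r, all (fun p => touch p.1 p.2) s &
    triangular [seq (edge_id (occupant p.1), edge_id (occupant p.2)) | p <- s]].

Lemma piece_adj_csym : connect_sym piece_adj.
Proof.
apply: sym_connect_sym => u v.
by apply/existsP/existsP => -[d /existsP[e de]]; exists e; apply/existsP; exists d;
  rewrite touch_sym.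
Qed.

Lemma comp_ofK u : comp_of (comp_of u) = comp_of u.
Proof. exact/root_root/piece_adj_csym. Qed.

Lemma comp_of_touch x y : touch (occupant x) (occupant y) -> comp_of x.1 = comp_of y.1.
Proof.
move=> xy; apply/eqP; rewrite root_connect; last exact: piece_adj_csym.
apply/connect1/existsP; exists (occupant x).2; apply/existsP; exists (occupant y).2.
by rewrite /occupant in xy *.
Qed.

Lemma badP x y : touch x y -> bad x = ~~ touch (occupant x) (occupant y).
Proof.
move=> xy; apply/existsP/idP => [[z /andP[xz nt]]|nt]; last by exists y; rewrite xy.
by rewrite (touch_inj xy xz).
Qed.

Lemma bad_mate x y : touch x y -> bad x -> bad y.
Proof.
move=> xy; rewrite (badP xy) touch_sym.
by rewrite (@badP y x) // touch_sym.
Qed.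

Lemma leaf_bad x : leaf x -> bad x.
Proof.
case/andP => /existsP[y xy] /existsPn ex; rewrite (badP xy); exact: ex.
Qed.

Hypothesis sigma_inj : pieces_inj.

Lemma occupant_inj : injective occupant.
Proof.
case=> u d [v e] eq_o; have /sigma_inj /= uv := congr1 fst eq_o.
by have := congr1 snd eq_o; rewrite /= uv => /addIr->.
Qed.

(* Constraints are collected one at a time; each new one excludes the at most [d]
   half-edges of [X] lying on the original edges it involves. *)
Lemma greedy_independent (X : {set half_edge k}) (d : nat) :
  {in X, forall x, bad x} ->
  (forall x y, x \in X -> touch x y ->
    (#|[set z in X | edge_id (occupant z) \in
         [:: edge_id (occupant x); edge_id (occupant y)]]| <= d)%N) ->
  exists2 r, independent r & (#|X| <= d * r)%N.
Proof.
move=> Xbad Xd.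
pose eid x := edge_id (occupant x).
pose ids (s : seq (half_edge k * half_edge k)) := [seq (eid p.1, eid p.2) | p <- s].
suff main : forall N (Y : {set half_edge k}) s,
    (#|Y| <= N)%N -> Y \subset X -> all (fun p => touch p.1 p.2) s ->
    triangular (ids s) ->
    {in Y, forall x, eid x \notin unzip1 (ids s) ++ unzip2 (ids s)} ->
    exists s', [/\ all (fun p => touch p.1 p.2) s', triangular (ids s') &
      (#|Y| + d * size s <= d * size s')%N].
  have [//|//|//|s [st stri le_s]] := main #|X| X [::] (leqnn _) (subxx _).
  by rewrite muln0 addn0 in le_s; exists (size s) => //; exists s.
elim=> [|N IH] Y s.
  rewrite leqn0 => /eqP Y0 _ st stri _; exists s; split=> //.
  by rewrite Y0.
move=> YN YX st stri Ys.
have [Y0|[x xY]] := set_0Vmem Y.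
  by exists s; split=> //; rewrite Y0 cards0.
have xX := subsetP YX _ xY.
have /existsP[y /andP[xy nt]] := Xbad _ xX.
pose Z := [set z in X | eid z \in [:: eid x; eid y]].
have xZ : x \in Z by rewrite inE xX mem_head.
have YZ : (#|Y| <= #|Y :\: Z| + d)%N.
  rewrite -(cardsID Z Y) addnC leq_add2l.
  by apply: leq_trans (Xd _ _ xX xy); apply/subset_leq_card/subsetIr.
have [|||||s' [st' stri' le_s']] := IH (Y :\: Z) ((x, y) :: s).
- rewrite -ltnS (leq_trans _ YN) // proper_card //; apply/properP.
  by split; [apply: subsetDl | exists x; rewrite // inE xZ].
- by apply: subset_trans YX; apply: subsetDl.
- by rewrite /= xy.
- have := Ys _ xY; rewrite mem_cat negb_or => /andP[s1 s2].
  apply/and4P; split=> //=; rewrite edge_id_eq negb_or nt andbT.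
  by apply/eqP => /occupant_inj exy; rewrite exy touch_irr in xy.
- move=> z; rewrite inE => /andP[zZ zY].
  have := Ys _ zY; rewrite mem_cat negb_or => /andP[z1 z2].
  move: zZ; rewrite inE (subsetP YX _ zY) /= !inE negb_or => /andP[zx zy].
  by rewrite mem_cat !in_cons !negb_or zx zy z1 z2.
exists s'; split=> //; apply: leq_trans le_s'.
by rewrite /= mulnS addnA leq_add2r.
Qed.

Lemma card_edge_id (m : nat) (x : half_edge m) :
  (#|[set z | edge_id z == edge_id x]| <= 2)%N.
Proof.
have [/existsP[y xy]|/existsPn nx] := boolP [exists y, touch x y].
  apply: leq_trans (_ : #|[set x; y]| <= 2)%N; last by rewrite cards2; case: (_ != _).
  apply/subset_leq_card/subsetP => z; rewrite !inE edge_id_eq.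
  by case/orP => [->//|]; rewrite touch_sym => xz; rewrite (touch_inj xz xy) eqxx orbT.
apply: leq_trans (_ : #|[set x]| <= 2)%N; last by rewrite cards1.
apply/subset_leq_card/subsetP => z; rewrite !inE edge_id_eq.
by rewrite touch_sym (negPf (nx z)) orbF.
Qed.

(** A constraint involves two original edges with at most two half-edges each, whence the factor
    4. *)
Lemma bad_rank : exists2 r, independent r & (#|[set x | bad x]| <= 4 * r)%N.
Proof.
apply: greedy_independent => [x|x y _ xy]; first by rewrite inE.
rewrite -(card_imset _ occupant_inj).
apply: (@leq_trans #|[set z | edge_id z == edge_id (occupant x)] :|:
                     [set z | edge_id z == edge_id (occupant y)]|).
  apply/subset_leq_card/subsetP => _ /imsetP[z + ->].
  by rewrite !inE => /andP[_].
apply: leq_trans (leq_card_setU _ _) _.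
exact: (leq_add (card_edge_id _) (card_edge_id _)).
Qed.

(** The partner of a leaf is not in the window, so a constraint between [x] and [y] excludes no leaf
    other than [x] and [y]; this halves the factor of [bad_rank]. *)
Lemma leaf_rank : exists2 r, independent r & (#|[set x | leaf x]| <= 2 * r)%N.
Proof.
apply: greedy_independent => [x|x y _ xy]; first by rewrite inE; apply: leaf_bad.
apply: leq_trans (_ : #|[set x; y]| <= 2)%N; last by rewrite cards2; case: (_ != _).
apply/subset_leq_card/subsetP => z; rewrite !inE !edge_id_eq.
case/andP => /andP[_ /existsPn nz].
by rewrite !(negPf (nz _)) !orbF !(inj_eq occupant_inj).
Qed.

Lemma card_comp_sides (X : {set half_edge k}) (C : {set cell k}) :
  (forall u s, u \in C -> exists x, [/\ x \in X, comp_of x.1 = u & (occupant x).2 = s]) ->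
  (4 * #|C| <= #|X|)%N.
Proof.
move=> CX; pose f x := (comp_of x.1, (occupant x).2).
apply: leq_trans (leq_imset_card f (mem X)).
have -> : (4 * #|C|)%N = #|setX C [set: 'Z_4]| by rewrite cardsX cardsT card_ord mulnC.
apply/subset_leq_card/subsetP => -[u s]; rewrite inE => /andP[/= /(CX u s)[x [xX xu xs]] _].
by apply/imsetP; exists x => //; rewrite /f xu xs.
Qed.

(** Take the extremal piece of the component in direction [s]: a partner present in the window would
    belong to the same component. *)
Lemma exposed_side u (s : 'Z_4) : comp_of u = u ->
  exists x, [/\ exposed x, comp_of x.1 = u & (occupant x).2 = s].
Proof.
move=> uu; pose U := [set (sigma w).1 | w in [set w | comp_of w == u]].
have u0 : (sigma u).1 \in U by apply: imset_f; rewrite inE uu.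
have [c /imsetP[w + ->] cmax] := @extremal_cell n U _ s u0.
rewrite inE => /eqP wu; pose x : half_edge k := (w, s + (sigma w).2).
have ox : occupant x = ((sigma w).1, s) by rewrite /occupant /= addrK.
exists x; split; rewrite ?ox //; apply/existsPn => y.
apply/negP => xy; have /comp_of_touch /= wy := xy.
move: xy; rewrite ox => /cmax/negP; apply; apply: imset_f.
by rewrite inE -wy wu.
Qed.

Lemma card_no_mate : (#|[set x | ~~ has_mate x]| <= 4 * k)%N.
Proof.
(* A half-edge on the border of the window is determined by its side and its coordinate along that
   side. *)
pose f (x : half_edge k) : 'I_4 * 'I_k :=
  (x.2, if (x.2 == 0) || (x.2 == 2) then x.1.2 else x.1.1).
have -> : (4 * k)%N = #|{: 'I_4 * 'I_k}| by rewrite card_prod !card_ord.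
rewrite -(card_in_imset (f := f)) ?max_card //.
move=> [u d] [v e]; rewrite !inE => nu nv eqf.
have de : d = e := congr1 fst eqf.
have := congr1 snd eqf; rewrite /= -de {eqf} => fe.
have no_step w : ~~ has_mate (w, d) ->
    ~ (0 <= (row w)%:Z + row_step d < k%:Z) \/ ~ (0 <= (col w)%:Z + col_step d < k%:Z).
  move=> nw; apply/not_andP => -[h1 h2]; have [w' ww'] := neighbour_exists h1 h2.
  by move/existsPn/(_ (w', d + 2)): nw; rewrite ww'.
have lu := (row_lt u, col_lt u); have lv := (row_lt v, col_lt v).
move: nv; rewrite -de => /no_step nv; move/no_step: nu => nu.
congr (_, _); case: lu lv => lu1 lu2 [lv1 lv2].
have fe' : if (d == 0) || (d == 2) then col u = col v else row u = row v.
  by move: fe; case: ifP => _ e'; rewrite /row /col e'.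
apply: cell_eq; move: d fe' nu nv {de fe no_step};
  by elim/side_ind; rewrite /row_step /col_step /=; lia.
Qed.

Lemma ncomp_le_leaf : (4 * ncomp <= #|[set x | leaf x]| + 4 * k)%N.
Proof.
apply: (@leq_trans #|[set x | exposed x]|).
  apply: card_comp_sides => u s; rewrite inE => /eqP/(exposed_side s)[x [ex xu xs]].
  by exists x; rewrite inE.
apply: leq_trans (leq_add (leqnn _) card_no_mate).
apply: leq_trans (leq_card_setU _ _); apply/subset_leq_card/subsetP => x.
by rewrite !inE /leaf => ->; rewrite andbT orbN.
Qed.

End Patch.

(** * Rigid motions and window boundaries *)

(* The piece expected at position [u] under rotation [r] and translation [t]: a
   step along side [d] of the position is a step along side [d - r] of the piece. *)
Definition motion_row k (t : int * int) (r : 'Z_4) (u : cell k) : int :=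
  t.1 + (row u)%:Z * row_step (2 - r) + (col u)%:Z * row_step (1 - r).
Definition motion_col k (t : int * int) (r : 'Z_4) (u : cell k) : int :=
  t.2 + (row u)%:Z * col_step (2 - r) + (col u)%:Z * col_step (1 - r).

Lemma row_step_rot (d r : 'Z_4) : row_step (d - r) =
  row_step d * row_step (2 - r) + col_step d * row_step (1 - r).
Proof. by elim/side_ind: d; elim/side_ind: r. Qed.

Lemma col_step_rot (d r : 'Z_4) : col_step (d - r) =
  row_step d * col_step (2 - r) + col_step d * col_step (1 - r).
Proof. by elim/side_ind: d; elim/side_ind: r. Qed.

Lemma motion_row_touch k t r (x y : half_edge k) : touch x y ->
  motion_row t r y.1 = motion_row t r x.1 + row_step (x.2 - r).
Proof.
rewrite touchE /motion_row => /and3P[_ /eqP -> /eqP ->].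
by rewrite row_step_rot !mulrDl !addrA; lia.
Qed.

Lemma motion_col_touch k t r (x y : half_edge k) : touch x y ->
  motion_col t r y.1 = motion_col t r x.1 + col_step (x.2 - r).
Proof.
rewrite touchE /motion_col => /and3P[_ /eqP -> /eqP ->].
by rewrite col_step_rot !mulrDl !addrA; lia.
Qed.

Lemma motion_inj k t r (u v : cell k) :
  motion_row t r u = motion_row t r v -> motion_col t r u = motion_col t r v -> u = v.
Proof.
rewrite /motion_row /motion_col => h1 h2; apply: cell_eq; move: h1 h2;
  by elim/side_ind: r; rewrite /row_step /col_step /=; lia.
Qed.

Definition motion_to k n (t : int * int) (r : 'Z_4) (u : cell k) (c : cell n) : bool :=
  ((row c)%:Z == motion_row t r u) && ((col c)%:Z == motion_col t r u).

Lemma motion_to_inj k n t r (u : cell k) (c c' : cell n) :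
  motion_to t r u c -> motion_to t r u c' -> c = c'.
Proof. by move=> /andP[/eqP h1 /eqP h2] /andP[/eqP h3 /eqP h4]; apply: cell_eq; lia. Qed.

Lemma motion_to_touch k n t r (x y : half_edge k) (c c' : cell n) : touch x y ->
  motion_to t r x.1 c -> motion_to t r y.1 c' = touch (c, x.2 - r) (c', y.2 - r).
Proof.
move=> xy /andP[/eqP h1 /eqP h2]; rewrite /motion_to touchE /=.
rewrite (motion_row_touch t r xy) (motion_col_touch t r xy) h1 h2.
by rewrite (touch_side xy) (addrAC x.2) eqxx.
Qed.

Definition right_place k n (sigma : patch k n) t r (u : cell k) : bool :=
  ((sigma u).2 == r) && motion_to t r u (sigma u).1.

(** The translation for which the motion with rotation [r] expects [c] at [u]. *)
Definition motion_shift k n (u : cell k) (c : cell n) (r : 'Z_4) : int * int :=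
  ((row c)%:Z - motion_row (0, 0) r u, (col c)%:Z - motion_col (0, 0) r u).

Lemma right_place_base k n (sigma : patch k n) (u : cell k) :
  right_place sigma (motion_shift u (sigma u).1 (sigma u).2) (sigma u).2 u.
Proof.
rewrite /right_place eqxx /motion_to /motion_shift /motion_row /motion_col /=.
by lia.
Qed.

Lemma right_place_step k n (sigma : patch k n) t r (x y : half_edge k) : touch x y ->
  touch (occupant sigma x) (occupant sigma y) ->
  right_place sigma t r x.1 -> right_place sigma t r y.1.
Proof.
move=> xy oxy /andP[/eqP xr xm].
have yr : (sigma y.1).2 = r.
  have := touch_side oxy; rewrite /= xr (touch_side xy) => e.
  by apply/oppr_inj/(addrI (x.2 + 2)); rewrite e addrAC.
by rewrite /right_place yr eqxx (motion_to_touch _ xy xm) -{1}xr -{1}yr.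
Qed.

Lemma right_place_touch k n (sigma : patch k n) t r (x y : half_edge k) : touch x y ->
  right_place sigma t r x.1 -> right_place sigma t r y.1 ->
  touch (occupant sigma x) (occupant sigma y).
Proof.
move=> xy /andP[/eqP xr xm] /andP[/eqP yr].
by rewrite (motion_to_touch _ xy xm) /occupant xr yr.
Qed.

Section Boundary.
Variables (k n : nat) (sigma : patch k.+1 n).
Hypothesis sigma_inj : pieces_inj sigma.

Definition on_boundary (u : cell k.+1) : bool :=
  [|| row u == 0%N, row u == k, col u == 0%N | col u == k].

(** All sides of a boundary cell count, including the inward one. *)
Definition side_bad : {set half_edge k.+1} :=
  [set x | bad sigma x & on_boundary x.1].

(** Taking plain naturals avoids bound proofs in inductions; the value is meaningful only for
    indices at most [k]. *)
Definition at_ij (i j : nat) : cell k.+1 := (inord i, inord j).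

Lemma row_at i j : (i <= k)%N -> row (at_ij i j) = i.
Proof. by move=> ik; rewrite /row /= inordK. Qed.

Lemma col_at i j : (j <= k)%N -> col (at_ij i j) = j.
Proof. by move=> jk; rewrite /col /= inordK. Qed.

Lemma at_row_col u : at_ij (row u) (col u) = u.
Proof. by apply: cell_eq; rewrite ?row_at ?col_at // -ltnS ?row_lt ?col_lt. Qed.

Lemma touch_at_right i j : (i <= k)%N -> (j < k)%N ->
  touch (at_ij i j, 1) (at_ij i j.+1, 1 + 2).
Proof.
move=> ik jk; rewrite touchE /= ?eqxx !row_at ?col_at // ?(ltnW jk) //.
by rewrite /row_step /col_step /=; lia.
Qed.

Lemma touch_at_below i j : (i < k)%N -> (j <= k)%N ->
  touch (at_ij i j, 2) (at_ij i.+1 j, 2 + 2).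
Proof.
move=> ik jk; rewrite touchE /= ?eqxx !row_at ?col_at // ?(ltnW ik) //.
by rewrite /row_step /col_step /=; lia.
Qed.

Lemma interior_has_mate (x : half_edge k.+1) : ~~ on_boundary x.1 -> has_mate x.
Proof.
move=> ub; case: x ub => u d /= ub.
have [||v uv] := @neighbour_exists _ u d; last by apply/existsP; exists (v, d + 2).
  have := row_lt u; move: ub; rewrite /on_boundary.
  by elim/side_ind: d; rewrite /row_step /=; lia.
have := col_lt u; move: ub; rewrite /on_boundary.
by elim/side_ind: d; rewrite /col_step /=; lia.
Qed.

(** The boundary is connected: every cell is reached from the corner by at most one horizontal and
    one vertical run along it. *)
Lemma boundary_ind (P : cell k.+1 -> Prop) : P (at_ij 0 0) ->
  (forall x y, touch x y -> on_boundary x.1 -> on_boundary y.1 -> P x.1 -> P y.1) ->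
  forall u, on_boundary u -> P u.
Proof.
move=> P0 Pstep.
have horizontal i j : (i = 0 \/ i = k)%N -> (j <= k)%N -> P (at_ij i 0) -> P (at_ij i j).
  move=> iP; elim: j => [//|j IH] jk Pi.
  have ik : (i <= k)%N by case: iP => ->.
  apply: (Pstep _ _ (touch_at_right ik jk) _ _ (IH (ltnW jk) Pi));
    by rewrite /on_boundary /= row_at //; case: iP => ->; rewrite eqxx ?orbT.
have vertical i j : (j = 0 \/ j = k)%N -> (i <= k)%N -> P (at_ij 0 j) -> P (at_ij i j).
  move=> jP; elim: i => [//|i IH] ik Pj.
  have jk : (j <= k)%N by case: jP => ->.
  apply: (Pstep _ _ (touch_at_below ik jk) _ _ (IH (ltnW ik) Pj));
    by rewrite /on_boundary /= col_at //; case: jP => ->; rewrite eqxx ?orbT.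
move=> u; rewrite -(at_row_col u).
have := row_lt u; have := col_lt u; rewrite !ltnS => cu ru.
rewrite /on_boundary row_at // col_at // => /or4P[] /eqP e; rewrite e.
- by apply: horizontal => //; left.
- by apply: horizontal => //; [right | apply: vertical => //; left].
- by apply: vertical => //; left.
by apply: vertical => //; [right | apply: horizontal => //; left].
Qed.

(** Every value other than [f 0] occurs directly after some change. *)
Lemma card_path_values (T : finType) (f : nat -> T) N :
  (#|[set f i | i : 'I_N.+1]| <= 1 + #|[set i : 'I_N | f i != f i.+1]|)%N.
Proof.
pose later := [set f (i : 'I_N).+1 | i in [set i : 'I_N | f i != f i.+1]].
apply: (@leq_trans #|f 0%N |: later|)%N.
  apply/subset_leq_card/subsetP => _ /imsetP[[i iN] _ ->] /=.
  elim: i iN => [|i IH] iN; first by rewrite !inE eqxx.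
  have [fi|fi] := eqVneq (f i) (f i.+1); first by rewrite -fi; apply/IH/ltnW.
  rewrite inE; apply/orP; right; apply/imsetP.
  by exists (Ordinal (iN : (i < N)%N)); rewrite ?inE.
by rewrite (leq_trans (leq_card_setU _ _)) // cards1 leq_add2l leq_imset_card.
Qed.

(** Along a side of the window the component can change only across a bad adjacency. *)
Lemma card_side_comps (c : nat -> cell k.+1) (d : 'Z_4) :
  (forall i, (i <= k)%N -> on_boundary (c i)) ->
  (forall i, (i < k)%N -> touch (c i, d) (c i.+1, d + 2)) ->
  (forall i j, (i < k)%N -> (j < k)%N -> c i = c j -> i = j) ->
  (#|[set comp_of sigma (c i) | i : 'I_k.+1]| <= 1 + #|side_bad|)%N.
Proof.
move=> cb ct cinj; apply: leq_trans (card_path_values (fun i => comp_of sigma (c i)) _) _.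
rewrite leq_add2l -(card_in_imset (f := fun i : 'I_k => (c i, d) : half_edge k.+1)).
  apply/subset_leq_card/subsetP => _ /imsetP[i + ->]; rewrite !inE => ni.
  rewrite /= cb ?andbT; last exact/ltnW/ltn_ord.
  rewrite (badP _ (ct _ (ltn_ord i))); apply: contra ni => /comp_of_touch /= ->.
  exact: eqxx.
by move=> i j _ _ e; apply: ord_inj; apply: cinj => //; exact: (congr1 fst e).
Qed.

Definition boundary_comps : {set cell k.+1} :=
  [set comp_of sigma u | u in [set u | on_boundary u]].

Lemma card_boundary_comps : (#|boundary_comps| <= 4 * (1 + #|side_bad|))%N.
Proof.
pose img (c : nat -> cell k.+1) := [set comp_of sigma (c i) | i : 'I_k.+1].
have sub : boundary_comps \subset
    (img (at_ij 0) :|: img (at_ij k)) :|: (img (at_ij^~ 0%N) :|: img (at_ij^~ k)).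
  apply/subsetP => _ /imsetP[u + ->]; rewrite !inE => ub.
  have row_i : (row u < k.+1)%N := row_lt u.
  have col_i : (col u < k.+1)%N := col_lt u.
  rewrite -(at_row_col u).
  case/or4P: ub => /eqP ->; apply/orP; [left|left|right|right]; apply/orP;
    [left|right|left|right]; apply/imsetP.
  - by exists (Ordinal col_i).
  - by exists (Ordinal col_i).
  - by exists (Ordinal row_i).
  - by exists (Ordinal row_i).
have hor i : (i = 0 \/ i = k)%N -> (#|img (at_ij i)| <= 1 + #|side_bad|)%N.
  move=> iP; have ik : (i <= k)%N by case: iP => ->.
  apply: (@card_side_comps _ 1) => [j jk|j jk|j j' jk jk' e].
  - by rewrite /on_boundary row_at //; case: iP => ->; rewrite eqxx ?orbT.
  - exact: touch_at_right.
  by rewrite -(@col_at i j) ?(ltnW jk) // e col_at // ltnW.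
have ver j : (j = 0 \/ j = k)%N -> (#|img (at_ij^~ j)| <= 1 + #|side_bad|)%N.
  move=> jP; have jk : (j <= k)%N by case: jP => ->.
  apply: (@card_side_comps _ 2) => [i ik|i ik|i i' ik ik' e].
  - by rewrite /on_boundary col_at //; case: jP => ->; rewrite eqxx ?orbT.
  - exact: touch_at_below.
  by rewrite -(@row_at i j) ?(ltnW ik) // e row_at // ltnW.
apply: leq_trans (subset_leq_card sub) _.
apply: leq_trans (leq_card_setU _ _) _.
apply: leq_trans (leq_add (leq_card_setU _ _) (leq_card_setU _ _)) _.
have := hor 0%N (or_introl erefl); have := hor k (or_intror erefl).
have := ver 0%N (or_introl erefl); have := ver k (or_intror erefl).
by lia.
Qed.

(** The four exposed half-edges of a component avoiding the boundary sit at interior cells, which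
    have neighbours on all sides, so they are leaves. *)
Lemma interior_comps_leaf :
  (4 * (ncomp sigma - #|boundary_comps|) <= #|[set x | leaf sigma x]|)%N.
Proof.
pose C := [set u | comp_of sigma u == u] :\: boundary_comps.
apply: (@leq_trans (4 * #|C|)).
  by rewrite leq_mul2l /= cardsD leq_sub2l // subset_leq_card ?subsetIr.
apply: card_comp_sides => u s; rewrite !inE => /andP[ub /eqP uu].
have [x [ex xu xs]] := exposed_side s uu.
exists x; split; [rewrite inE /leaf ex andbT interior_has_mate // | exact: xu | exact: xs].
by apply: contra ub => xb; rewrite -xu; apply: imset_f; rewrite inE.
Qed.

End Boundary.

(** * Concentric windows *)

Section Window.
Variables (k N n a b : nat) (sigma : patch N.+1 n).
Hypotheses (aN : (a + k <= N.+1)%N) (bN : (b + k <= N.+1)%N).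

Definition shift (u : cell k) : cell N.+1 := at_ij N (a + row u) (b + col u).

Definition shift_half (x : half_edge k) : half_edge N.+1 := (shift x.1, x.2).

Definition window : patch k n := [ffun u => sigma (shift u)].

Lemma row_shift u : row (shift u) = (a + row u)%N.
Proof. by rewrite row_at // -ltnS (leq_trans _ aN) // ltn_add2l row_lt. Qed.

Lemma col_shift u : col (shift u) = (b + col u)%N.
Proof. by rewrite col_at // -ltnS (leq_trans _ bN) // ltn_add2l col_lt. Qed.

Lemma shift_inj : injective shift.
Proof.
move=> u v e; apply: cell_eq; apply/eqP.
  by rewrite -(eqn_add2l a) -!row_shift e.
by rewrite -(eqn_add2l b) -!col_shift e.
Qed.

Lemma shift_half_inj : injective shift_half.
Proof.
move=> [u d] [v e] eqs; have /shift_inj -> : shift u = shift v := congr1 fst eqs.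
by congr (_, _); exact: (congr1 snd eqs).
Qed.

Lemma touch_shift x y : touch (shift_half x) (shift_half y) = touch x y.
Proof. by rewrite !touchE /= !row_shift !col_shift !PoszD -!addrA !(inj_eq (addrI _)). Qed.

Lemma occupant_window x : occupant window x = occupant sigma (shift_half x).
Proof. by rewrite /occupant /= ffunE. Qed.

Lemma window_inj : pieces_inj sigma -> pieces_inj window.
Proof. by move=> s_inj u v; rewrite !ffunE => /s_inj/shift_inj. Qed.

Lemma window_valid q (g : colouring n q) : valid_patch sigma g -> valid_patch window g.
Proof. by move=> sg x y xy; rewrite !occupant_window; apply: sg; rewrite touch_shift. Qed.

(** The mate must be inside the window, since a half-edge on its border is never bad there. *)
Lemma bad_window x y : touch x y -> bad window x = bad sigma (shift_half x).
Proof.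
move=> xy; rewrite (badP window xy) !occupant_window.
by rewrite (@badP _ _ sigma (shift_half x) (shift_half y)) // touch_shift.
Qed.

Lemma bad_window_bad x : bad window x -> bad sigma (shift_half x).
Proof. by move=> bx; have /existsP[y /andP[xy _]] := bx; rewrite -(bad_window xy). Qed.

End Window.

Lemma sum_card_fibres (T : finType) (X : {set T}) (f : T -> nat) a b :
  (\sum_(a <= r < b) #|[set x in X | f x == r]| <= #|X|)%N.
Proof.
have card_fibre r : #|[set x in X | f x == r]| = (\sum_(x in X) (f x == r))%N.
  by rewrite -sum1_card big_mkcond /= [RHS]big_mkcond; apply: eq_bigr => x _;
    rewrite inE; case: (x \in X); case: eqP.
rewrite -sum1_card; under eq_bigr do rewrite card_fibre.
rewrite exchange_big leq_sum //= => x _.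
have -> : (\sum_(a <= r < b) (f x == r))%N = count (pred1 (f x)) (index_iota a b).
  by rewrite -sum1_count [RHS]big_mkcond; apply: eq_bigr => r _; rewrite eq_sym /=; case: eqP.
by rewrite count_uniq_mem ?iota_uniq // leq_b1.
Qed.

(** For [n^-1 = alpha^m] and [q^-1 <= alpha^(m+1)], a violation gives the expected count
    [n^(2c) q^-r] a positive power of [alpha], where [c] is [ncomp sigma]. *)
Definition sparse k n (m : nat) (sigma : patch k n) : Prop :=
  forall r, independent sigma r -> (m.+1 * r <= 2 * m * ncomp sigma)%N.

Lemma sparse_bad k n m (sigma : patch k n) : pieces_inj sigma -> sparse m sigma ->
  (m.+1 * #|[set x | bad sigma x]| <= 8 * m * ncomp sigma)%N.
Proof. by move=> s_inj sp; have [r /sp] := bad_rank s_inj; nia. Qed.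

Lemma sparse_leaf k n m (sigma : patch k n) : pieces_inj sigma -> sparse m sigma ->
  (m.+1 * #|[set x | leaf sigma x]| <= 4 * m * ncomp sigma)%N.
Proof. by move=> s_inj sp; have [r /sp] := leaf_rank s_inj; nia. Qed.

Lemma sum_side4 (d : 'Z_4) : d + 2 + 2 = d.
Proof. by elim/side_ind: d; apply: val_inj. Qed.

(** * Windows with no bad adjacency at their boundary *)

Section CleanPatch.
Variables (k n m : nat) (sigma : patch k.+1 n).
Hypotheses (sigma_inj : pieces_inj sigma) (sigma_sparse : sparse m sigma).
Hypothesis side_good : side_bad sigma = set0.

Let A := comp_of sigma (at_ij k 0 0).

Let boundary_not_bad x y : touch x y -> on_boundary x.1 ->
  touch (occupant sigma x) (occupant sigma y).
Proof.
move=> xy xb; have : x \notin side_bad sigma by rewrite side_good inE.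
by rewrite inE xb andbT (badP _ xy) negbK.
Qed.

Let boundary_comp u : on_boundary u -> comp_of sigma u = A.
Proof.
move: u; apply: boundary_ind => // x y xy xb _ <-.
by apply/esym/comp_of_touch/boundary_not_bad.
Qed.

Section Motion.
Variables (t : int * int) (r : 'Z_4).
Hypothesis boundary_right : forall u, on_boundary u -> right_place sigma t r u.

Let wrong := [set u | ~~ right_place sigma t r u].
(* Positions of the window whose expected piece is not in the component [A] of
   the boundary: that component leaves exposed half-edges around a hole. *)
Let hole := [set u : cell k.+1 | ~~ [exists w, (comp_of sigma w == A) &&
                                   motion_to t r u (sigma w).1]].

(** In each direction an extremal wrong cell has a correct neighbour; the adjacency is bad from both
    ends, giving eight half-edges told apart by [f]. *)
Let wrong_bad u0 : u0 \in wrong -> (8 <= #|[set x | bad sigma x]|)%N.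
Proof.
move=> u0w; pose f (x : half_edge k.+1) := (x.2, x.1 \in wrong).
apply: leq_trans (leq_imset_card f (mem [set x | bad sigma x])).
have -> : 8%N = #|[set: 'Z_4 * bool]| by rewrite cardsT card_prod card_ord card_bool.
have both d : exists x y, [/\ touch x y, x.2 = d, x.1 \in wrong & y.1 \notin wrong].
  have [u uw umax] := extremal_cell d u0w.
  have ub : ~~ on_boundary u.
    by apply: contraL uw => /boundary_right ru; rewrite inE ru.
  have /existsP[y uy] := @interior_has_mate k (u, d) ub.
  by exists (u, d), y; split=> //; apply: umax.
have both_bad x y : touch x y -> x.1 \in wrong -> y.1 \notin wrong -> bad sigma x.
  move=> xy; rewrite !inE negbK (badP _ xy) => xw yr; apply: contra xw => oxy.
  by apply: right_place_step yr; rewrite touch_sym; [exact: xy | exact: oxy].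
apply/subset_leq_card/subsetP => -[d []] _; apply/imsetP.
  have [x [y [xy xd xw yw]]] := both d.
  by exists x; rewrite ?inE ?(both_bad _ _ xy) // /f xd xw.
have [x [y [xy xd xw yw]]] := both (d + 2).
exists y; first by rewrite inE (bad_mate xy) ?(both_bad _ _ xy).
by rewrite /f (negPf yw) (touch_side xy) xd sum_side4.
Qed.

(** Choosing for each position a cell of [A] that holds its expected piece is injective, hence
    surjective, so all cells belong to [A]. *)
Let no_hole : hole = set0 -> (ncomp sigma <= 1)%N.
Proof.
move=> hole0.
have filled (u : cell k.+1) : exists w, (comp_of sigma w == A) && motion_to t r u (sigma w).1.
  apply/existsP; have : u \notin hole by rewrite hole0 inE.
  by rewrite inE negbK.
pose h (u : cell k.+1) := odflt u [pick w | (comp_of sigma w == A) && motion_to t r u (sigma w).1].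
have hP u : comp_of sigma (h u) = A /\ motion_to t r u (sigma (h u)).1.
  rewrite /h; case: pickP => [w /andP[/eqP]//|nw].
  by have [w wP] := filled u; rewrite nw in wP.
have h_inj : injective h.
  move=> u v huv; have [_ /andP[/eqP u1 /eqP u2]] := hP u.
  have [_ /andP[/eqP v1 /eqP v2]] := hP v.
  by apply: (@motion_inj _ t r); rewrite -?u1 -?u2 -?v1 -?v2 huv.
have all_A u : comp_of sigma u = A.
  by have [h' _ hK] := injF_bij h_inj; have [+ _] := hP (h' u); rewrite hK.
rewrite -(cards1 A); apply/subset_leq_card/subsetP => u.
by rewrite !inE all_A eq_sym.
Qed.

(** Components other than [A] avoid the boundary, so their exposed half-edges are leaves; for [A] a
    leaf in each direction is found next to a hole. *)
Let hole_leaf v0 : v0 \in hole -> (4 * ncomp sigma <= #|[set x | leaf sigma x]|)%N.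
Proof.
move=> v0h; apply: card_comp_sides => u s; rewrite inE => /eqP uu.
have [uA|uA] := eqVneq u A; last first.
  have [x [ex xu xs]] := exposed_side s uu.
  exists x; split; [|exact: xu|exact: xs].
  rewrite inE /leaf ex andbT interior_has_mate //.
  by apply: contraNN uA => /boundary_comp; rewrite xu => ->.
(* Side [s] of a piece corresponds to side [d] of positions under the motion. The piece expected
   just before the extremal hole is in [A], and the one expected in the hole is not. *)
pose d := s + r.
have [v vh vmax] := extremal_cell (d + 2) v0h.
have vb : ~~ on_boundary v.
  apply: contraL vh => vb; rewrite inE negbK; apply/existsP; exists v.
  by rewrite boundary_comp //= eqxx; have /andP[] := boundary_right vb.
have /existsP[y vy] := @interior_has_mate k (v, d + 2) vb.
have := vmax _ vy; rewrite inE negbK => /existsP[w /andP[/eqP wA yw]].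
have yd : y.2 = d by rewrite (touch_side vy) sum_side4.
pose x : half_edge k.+1 := (w, s + (sigma w).2).
have ox : occupant sigma x = ((sigma w).1, s) by rewrite /occupant /= addrK.
have yv : touch y (v, d + 2) by rewrite touch_sym.
exists x; split; rewrite ?ox //; last by rewrite wA uA.
rewrite inE; apply/andP; split.
  (* If [w] is on the boundary, its piece is in place, so [w] is the neighbour [y.1] of the hole and
     has a mate on side [d]. *)
  have [/boundary_right/andP[/eqP wr /andP[/eqP w1 /eqP w2]]|wb] := boolP (on_boundary w).
    have wy : w = y.1.
      by case/andP: yw => /eqP y1 /eqP y2; apply: (@motion_inj _ t r); rewrite -?w1 -?w2.
    apply/existsP; exists (v, d + 2); suff -> : x = y by [].
    by rewrite /x wr wy -/d -yd -surjective_pairing.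
  exact: interior_has_mate.
apply/existsPn => z; apply/negP => xz; suff: v \notin hole by rewrite vh.
rewrite inE negbK; apply/existsP; exists z.1.
rewrite -(comp_of_touch xz) wA eqxx /=.
rewrite (motion_to_touch _ yv yw) yd /= /d addrK addrAC addrK.
move: xz; rewrite ox => xz.
by have := touch_side xz; rewrite /= => {1}<-.
Qed.

(** Without a hole [ncomp <= 1], and sparsity leaves fewer than eight bad half-edges. With a hole,
    [4 * ncomp] leaves force [ncomp = 0], hence no bad half-edge. *)
Lemma wrong_cells_none u : right_place sigma t r u.
Proof.
apply/negPn/negP => nu; have uw : u \in wrong by rewrite inE.
have b8 := wrong_bad uw.
have sb := sparse_bad sigma_inj sigma_sparse.
have sl := sparse_leaf sigma_inj sigma_sparse.
have [/no_hole|[v /hole_leaf]] := set_0Vmem hole; nia.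
Qed.

End Motion.

Lemma clean_patch_not_bad x : ~~ bad sigma x.
Proof.
have tP := right_place_base sigma (at_ij k 0 0).
set t := motion_shift _ _ _ in tP; set r := (sigma _).2 in t tP.
have all_right : forall u, right_place sigma t r u.
  apply: wrong_cells_none; apply: boundary_ind => // y z yz yb _.
  by apply: right_place_step => //; apply: boundary_not_bad.
apply/negP => /existsP[y /andP[xy /negP]]; apply.
exact: right_place_touch xy (all_right _) (all_right _).
Qed.

End CleanPatch.

(* [radius m] exceeds the number of bad half-edges that sparsity leaves in a
   window with at most [40 * m] of them on its boundary. *)
Definition radius (m : nat) : nat := (32 * m * (1 + 40 * m)).+1.

(** * The centre of a large window *)

Section Centre.
Variables (n R : nat) (sigma : patch R.*2.+1 n).

Definition central (r : nat) : patch r.*2.+1 n := window r.*2.+1 (R - r) (R - r) sigma.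

Let bound r : (r <= R)%N -> (R - r + r.*2.+1 <= R.*2.+1)%N.
Proof. by move=> rR; lia. Qed.

(** Sup-norm distance to the centre; with truncated subtraction, the maximum of both differences is
    the absolute value. *)
Let dist (u : cell R.*2.+1) : nat :=
  maxn (maxn (row u - R) (R - row u)) (maxn (col u - R) (R - col u)).

Lemma side_bad_central r : (r <= R)%N -> (#|side_bad (central r)| <=
  #|[set x in [set x | bad sigma x] | dist x.1 == r]|)%N.
Proof.
move=> rR; have b := bound rR.
rewrite -(card_imset _ (shift_half_inj b b)).
apply/subset_leq_card/subsetP => _ /imsetP[x + ->].
rewrite !inE => /andP[/(bad_window_bad b b) -> xb] /=.
rewrite /dist /= row_shift // col_shift //.
have := row_lt x.1; have := col_lt x.1; move: xb; rewrite /on_boundary {b}.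
by move: (row _) (col _) => i j; lia.
Qed.

(** Averaging over the [b - a] disjoint rings of radius in [(a, b]]. *)
Lemma exists_good_radius a b : (a < b)%N -> (b <= R)%N ->
  exists r, [/\ (a < r)%N, (r <= b)%N &
    ((b - a) * #|side_bad (central r)| <= #|[set x | bad sigma x]|)%N].
Proof.
move=> ab bR; set B := [set x | bad sigma x].
apply/not_existsP => no_r.
have many r : (a < r <= b)%N -> (#|B|.+1 <= (b - a) * #|side_bad (central r)|)%N.
  by move=> /andP[ar rb]; rewrite ltnNge; apply/negP => le_r; apply: (no_r r).
have := sum_card_fibres B (fun x => dist x.1) a.+1 b.+1.
rewrite leqNgt => /negP; apply.
rewrite -(@ltn_pmul2l (b - a)) ?subn_gt0 // big_distrr /=.
apply: (@leq_trans (\sum_(a.+1 <= r < b.+1) #|B|.+1)).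
  by rewrite sum_nat_const_nat subSS ltn_pmul2l ?subn_gt0.
rewrite !big_nat; apply: leq_sum => r /andP[ar rb].
apply: leq_trans (many r _) _; first by rewrite ar -ltnS.
by rewrite leq_mul2l side_bad_central ?orbT // (leq_trans _ bR) // -ltnS.
Qed.

Lemma central_inj r : (r <= R)%N -> pieces_inj sigma -> pieces_inj (central r).
Proof. by move=> rR; have b := bound rR; apply: window_inj. Qed.

Lemma central_valid r q (g : colouring n q) : (r <= R)%N ->
  valid_patch sigma g -> valid_patch (central r) g.
Proof. by move=> rR; have b := bound rR; apply: window_valid. Qed.

Lemma central_not_bad r d : (0 < r)%N -> (r <= R)%N ->
  ~~ bad (central r) (at_ij r.*2 r r, d) -> ~~ bad sigma (at_ij R.*2 R R, d).
Proof.
move=> r_gt0 rR; have b := bound rR; have r2 : (r <= r.*2)%N by lia.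
have rb : ~~ on_boundary (at_ij r.*2 r r).
  by rewrite /on_boundary row_at // col_at //; lia.
have /existsP[y ry] := @interior_has_mate _ (at_ij r.*2 r r, d) rb.
rewrite (bad_window sigma b b ry); congr (~~ bad sigma (_, d)).
by apply: cell_eq; rewrite /= ?row_shift ?col_shift ?row_at ?col_at //; lia.
Qed.

End Centre.

Lemma centre_not_bad n q (g : colouring n q) m
    (sigma : patch (radius m).*2.*2.+1 n) (d : 'Z_4) :
  pieces_inj sigma -> valid_patch sigma g ->
  (forall r (tau : patch r.*2.+1 n), (r <= (radius m).*2)%N ->
     pieces_inj tau -> valid_patch tau g -> sparse m tau) ->
  ~~ bad sigma (at_ij _ (radius m).*2 (radius m).*2, d).
Proof.
set a := radius m => s_inj sg sp.
have a_gt0 : (0 < a)%N by [].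
have s_sp := sp _ sigma (leqnn _) s_inj sg.
(* Counting components by leaves and border gives [ncomp <= (4a+1)(m+1)], hence at most
   [8m(4a+1) <= 40ma] bad half-edges. *)
have s_bad : (#|[set x | bad sigma x]| <= 40 * m * a)%N.
  have := sparse_bad s_inj s_sp; have := sparse_leaf s_inj s_sp.
  have := ncomp_le_leaf sigma; move: #|_| #|_| (ncomp _) => L B c h1 h2 h3.
  have : (c <= a.*2.*2.+1 * m.+1)%N by nia.
  nia.
have [|r [ar ra s_r]] := @exists_good_radius _ _ sigma a a.*2 _ (leqnn _); first by lia.
have side_r : (#|side_bad (central sigma r)| <= 40 * m)%N by nia.
set tau := central sigma r in s_r side_r.
have t_inj : pieces_inj tau by apply: central_inj.
have tg : valid_patch tau g by apply: central_valid.
have t_sp := sp _ tau ra t_inj tg.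
(* Now only boundary components count: [c <= (m+1) C] with [C <= 4(1 + 40m)], so at most [8mC]
   half-edges are bad, which is below [radius m]. *)
have t_bad : (#|[set x | bad tau x]| < r)%N.
  apply: leq_ltn_trans ar.
  have := sparse_bad t_inj t_sp; have := sparse_leaf t_inj t_sp.
  have := interior_comps_leaf tau; have := card_boundary_comps tau.
  rewrite /a /radius; move: #|side_bad _| side_r #|boundary_comps _| => S Sm C CS.
  move: #|_| #|_| (ncomp _) => L B c h1 h2 h3.
  have CM : (C <= 4 * (1 + 40 * m))%N by lia.
  have c_le : (c <= m.+1 * C)%N by nia.
  have : (m.+1 * B <= m.+1 * (8 * m * C))%N by nia.
  by rewrite leq_pmul2l // => B_le; nia.
have r_gt0 : (0 < r)%N by apply: leq_ltn_trans ar.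
(* Fewer than [r] bad half-edges are spread over [r] rings, so some ring has none. *)
have [r' [r'_gt0 r'r t_r']] := @exists_good_radius _ _ tau 0 r r_gt0 (leqnn _).
have side0 : side_bad (central tau r') = set0.
  apply/eqP; rewrite -cards_eq0 -leqn0 -ltnS -(@ltn_pmul2l r) // muln1.
  by apply: leq_ltn_trans t_bad; rewrite subn0 in t_r'.
apply: (central_not_bad r_gt0 ra).
apply: (central_not_bad r'_gt0 r'r).
apply: (clean_patch_not_bad (m := m)) => //; first exact: central_inj.
apply: sp; first exact: leq_trans r'r ra.
  exact: central_inj.
exact: central_valid.
Qed.

(** * Most windows are sparse *)

Section CountPatches.
Variables (k n : nat).
Implicit Types (sigma : patch k n).

Lemma piece_adj_close sigma u v : piece_adj sigma u v ->
  (row (sigma u).1 <= row (sigma v).1 + 1)%N /\ (col (sigma u).1 <= col (sigma v).1 + 1)%N.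
Proof.
case/existsP => d /existsP[e]; rewrite touchE /= => /and3P[_ /eqP h1 /eqP h2].
by move: h1 h2; elim/side_ind: d; rewrite /row_step /col_step /=; lia.
Qed.

Lemma connect_close sigma u v : connect (piece_adj sigma) u v ->
  (row (sigma u).1 <= row (sigma v).1 + k ^ 2)%N /\
  (col (sigma u).1 <= col (sigma v).1 + k ^ 2)%N.
Proof.
have path_close p : forall w, path (piece_adj sigma) w p ->
    (row (sigma w).1 <= row (sigma (last w p)).1 + size p)%N /\
    (col (sigma w).1 <= col (sigma (last w p)).1 + size p)%N.
  elim: p => [|w' p IH] w; first by rewrite !addn0.
  case/andP => /piece_adj_close[h1 h2] /IH[h3 h4].
  by split; [apply: leq_trans h1 _ | apply: leq_trans h2 _]; rewrite addn1 addnS ltnS.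
case/connectP => p up ->; case/shortenP: up => p' up' uniq_p' _.
have size_p' : (size p' <= k ^ 2)%N.
  have := max_card (mem (u :: p')); rewrite (card_uniqP uniq_p') card_prod !card_ord /=.
  by rewrite mulnn => /ltnW.
have [h1 h2] := path_close _ _ up'.
by split; [apply: leq_trans h1 _ | apply: leq_trans h2 _]; rewrite leq_add2l.
Qed.

Definition displacement_bound : nat := (k ^ 2).*2.

Definition comp_code : finType :=
  ((cell n + ('I_displacement_bound.+1 * 'I_displacement_bound.+1)) * 'Z_4)%type.

(** Adding [k ^ 2] keeps the differences nonnegative within a component. *)
Definition displacement (c c' : cell n) :
    'I_displacement_bound.+1 * 'I_displacement_bound.+1 :=
  (inord (row c + k ^ 2 - row c'), inord (col c + k ^ 2 - col c')).

Lemma displacement_inj (c c' c0 : cell n) :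
  (row c <= row c0 + k ^ 2)%N -> (col c <= col c0 + k ^ 2)%N ->
  (row c0 <= row c + k ^ 2)%N -> (col c0 <= col c + k ^ 2)%N ->
  (row c' <= row c0 + k ^ 2)%N -> (col c' <= col c0 + k ^ 2)%N ->
  (row c0 <= row c' + k ^ 2)%N -> (col c0 <= col c' + k ^ 2)%N ->
  displacement c c0 = displacement c' c0 -> c = c'.
Proof.
move=> h1 h2 h3 h4 h5 h6 h7 h8 e.
have := congr1 (fun p => val p.1) e; have := congr1 (fun p => val p.2) e.
rewrite /= !inordK ?ltnS /displacement_bound; [|lia..] => e1 e2.
by apply: cell_eq; lia.
Qed.

(* The root of each component is recorded by its cell, at a cost of [n ^ 2], and
   every other piece by its bounded displacement from its root. *)
Definition encode sigma : {ffun cell k -> comp_code} :=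
  [ffun u => (if comp_of sigma u == u then inl (sigma u).1
              else inr (displacement (sigma u).1 (sigma (comp_of sigma u)).1),
              (sigma u).2)].

Lemma encode_inj (f : {ffun cell k -> cell k}) :
  {in [pred sigma | [forall u, comp_of sigma u == f u]] &, injective encode}.
Proof.
move=> sigma tau; rewrite !inE => /forallP sf /forallP tf /ffunP enc.
have root_eq u : f u = u -> sigma u = tau u.
  move=> fu; have := enc u; rewrite !ffunE (eqP (sf u)) (eqP (tf u)) fu eqxx => e.
  have /= e1 := congr1 (fun z : comp_code => if z.1 is inl c then c else (sigma u).1) e.
  have /= e2 := congr1 snd e.
  by rewrite [LHS]surjective_pairing [RHS]surjective_pairing e1 e2.
apply/ffunP => u; have [/root_eq//|fu] := eqVneq (f u) u.
have ffu : f (f u) = f u by rewrite -(eqP (sf u)) -(eqP (sf _)) comp_ofK.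
have froot := root_eq _ ffu.
have := enc u; rewrite !ffunE (eqP (sf u)) (eqP (tf u)) (negPf fu) froot => e.
have := congr1 (fun z : comp_code => if z.1 is inr p then p else (ord0, ord0)) e.
have /= e3 := congr1 snd e.
rewrite [X in X -> _]/= => eq_d; rewrite [LHS]surjective_pairing [RHS]surjective_pairing e3; congr (_, _).
have con_s : connect (piece_adj sigma) u (f u).
  by rewrite -(eqP (sf u)) connect_root.
have con_t : connect (piece_adj tau) u (f u).
  by rewrite -(eqP (tf u)) connect_root.
have [s1 s2] := connect_close con_s; have [t1 t2] := connect_close con_t.
rewrite (piece_adj_csym sigma) in con_s; rewrite (piece_adj_csym tau) in con_t.
have [s3 s4] := connect_close con_s; have [t3 t4] := connect_close con_t.
rewrite froot in s1 s2 s3 s4.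
exact: displacement_inj eq_d.
Qed.

Lemma card_same_comps (f : {ffun cell k -> cell k}) :
  (#|[pred sigma : patch k n | [forall u, comp_of sigma u == f u]]| <=
   (n ^ 2) ^ #|[set u | f u == u]| * (4 * displacement_bound.+1 ^ 2) ^ (k ^ 2))%N.
Proof.
pose F u := [pred z : comp_code | (if z.1 is inl _ then true else false) == (f u == u)].
pose D := (4 * displacement_bound.+1 ^ 2)%N.
rewrite -(card_in_imset (@encode_inj f)).
apply: (@leq_trans #|family F|).
  apply/subset_leq_card/subsetP => _ /imsetP[sigma + ->]; rewrite inE => /forallP sf.
  apply/familyP => u; rewrite !inE ffunE /= (eqP (sf u)).
  by case: (f u == u).
rewrite card_family foldrE big_map big_enum /=.
have -> : ((n ^ 2) ^ #|[set u | f u == u]| * D ^ (k ^ 2) =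
           \prod_u ((if f u == u then n ^ 2 else 1) * D))%N.
  rewrite big_split /= -big_mkcond /= !prod_nat_const card_prod !card_ord mulnn.
  by congr (_ ^ _ * _)%N; apply: eq_card => u; rewrite inE.
apply: leq_prod => u _; rewrite /F.
have D4 : (4 <= D)%N by rewrite leq_pmulr // expn_gt0.
case: (f u == u).
  pose h (p : cell n * 'Z_4) : comp_code := (inl p.1, p.2).
  apply: (@leq_trans #|h @: [set: cell n * 'Z_4]|).
    apply/subset_leq_card/subsetP => -[[c|c] d] //= _.
    by apply/imsetP; exists (c, d); rewrite ?inE.
  apply: leq_trans (leq_imset_card _ _) _.
  by rewrite cardsT !card_prod !card_ord mulnn leq_mul2l D4 orbT.
rewrite mul1n.
pose E := ('I_displacement_bound.+1 * 'I_displacement_bound.+1)%type.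
pose h (p : E * 'Z_4) : comp_code := (inr p.1, p.2).
apply: (@leq_trans #|h @: [set: E * 'Z_4]|).
  apply/subset_leq_card/subsetP => -[[c|c] d] //= _.
  by apply/imsetP; exists (c, d); rewrite ?inE.
apply: leq_trans (leq_imset_card _ _) _.
by rewrite cardsT !card_prod !card_ord mulnn mulnC.
Qed.

Definition patch_const : nat :=
  (#|{ffun cell k -> cell k}| * (4 * displacement_bound.+1 ^ 2) ^ (k ^ 2))%N.

(** Grouping by the root function, a class with [c] components has at most a constant times [n^(2c)]
    patches. *)
Lemma sum_patches (R : realType) : (0 < n)%N ->
  \sum_(sigma : patch k n) (n%:R^-1 : R) ^+ (2 * ncomp sigma) <= patch_const%:R.
Proof.
move=> n_gt0; pose root_fun sigma : {ffun cell k -> cell k} := [ffun u => comp_of sigma u].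
rewrite (partition_big root_fun xpredT) //= /patch_const natrM -sumr_const.
rewrite mulr_suml ler_sum // => f _.
rewrite (eq_bigr (fun=> (n%:R^-1 : R) ^+ (2 * #|[set u | f u == u]|))); last first.
  move=> sigma /eqP sf; congr (_ ^+ (2 * _)); apply: eq_card => u.
  by rewrite !inE -sf ffunE.
rewrite mul1r sumr_const -[leLHS]mulr_natl exprVn ler_pdivrMr ?exprn_gt0 ?ltr0n //.
rewrite -natrX -natrM ler_nat [leqRHS]mulnC expnM.
apply: leq_trans (card_same_comps f); apply/subset_leq_card/subsetP => sigma.
move=> rf0; have rf : root_fun sigma = f by apply/eqP; exact: rf0.
by rewrite inE; apply/forallP => u; rewrite -rf ffunE.
Qed.

(** A violation [(m+1) r > 2 m c] gives [q^-r <= alpha * alpha^(2mc) = alpha * n^(-2c)], which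
    [sum_patches] sums up. *)
Lemma prob_not_sparse (R : realType) q m (alpha : R) : (0 < n)%N -> (0 < q)%N ->
  0 <= alpha <= 1 -> n%:R^-1 = alpha ^+ m -> q%:R^-1 <= alpha ^+ m.+1 ->
  prob R (fun g : colouring n q => exists sigma : patch k n,
    [/\ pieces_inj sigma, valid_patch sigma g & ~ sparse m sigma])
  <= alpha * patch_const%:R.
Proof.
move=> n_gt0 q_gt0 /andP[a_ge0 a_le1] n_alpha q_alpha.
pose S := [pred sigma : patch k n | `[< pieces_inj sigma /\ ~ sparse m sigma >]].
apply: (@le_trans _ _ (prob R (fun g : colouring n q =>
  exists2 sigma : patch k n, S sigma & valid_patch sigma g))).
  by apply: le_prob => g [sigma [s_inj sg ns]]; exists sigma => //; apply/asboolP.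
apply: le_trans (prob_exists _ _ _) _.
apply: le_trans (ler_wpM2l a_ge0 (sum_patches R n_gt0)).
rewrite mulr_sumr [leRHS](bigID S) /= -[leLHS]addr0 lerD //; last first.
  by rewrite sumr_ge0 // => sigma _; rewrite mulr_ge0 // exprn_ge0 // invr_ge0.
apply: ler_sum => sigma /asboolP[s_inj ns].
have [r [[s [<- /allP st stri]] /negP]] : exists r, independent sigma r /\
    ~ (m.+1 * r <= 2 * m * ncomp sigma)%N.
  by apply: contra_notP ns => /forallNP nr r ri; apply: contra_notP (nr r).
rewrite -ltnNge => lt_s.
pose s' := [seq (occupant sigma p.1, occupant sigma p.2) | p <- s].
apply: (@le_trans _ _ (q%:R^-1 ^+ size s')).
  apply: (le_trans (y := prob R (fun g : colouring n q =>
    forall p, p \in s' -> colour g p.1 = colour g p.2))).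
    by apply: le_prob => g sg _ /mapP[p ps ->]; apply: sg; apply: st.
  by apply: prob_triangular => //; rewrite -map_comp.
rewrite size_map n_alpha -exprM -exprS.
apply: (@le_trans _ _ ((alpha ^+ m.+1) ^+ size s)).
  by rewrite lerXn2r ?nnegrE ?invr_ge0 ?exprn_ge0.
by rewrite -exprM ler_wiXn2l //; lia.
Qed.

End CountPatches.

(** * Filling the border *)

Section Border.
Variables (N R : nat).
Hypothesis RN : (R + R <= N)%N.
Let n := N.+1.

Definition near c : {set 'I_n} := [set i : 'I_n | (i < c)%N || (n <= i + c)%N].

Definition inner : {set cell n} := setX (~: near R) (~: near R).

Lemma inner_at i j : (R <= i <= N - R)%N -> (R <= j <= N - R)%N -> at_ij N i j \in inner.
Proof. by move=> iR jR; rewrite !inE /= !inordK /n; lia. Qed.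

Lemma inner_ltP (u : cell n) : u \in inner ->
  [/\ (R <= row u)%N, (row u <= N - R)%N, (R <= col u)%N & (col u <= N - R)%N].
Proof.
case: u => i j; have := ltn_ord i; have := ltn_ord j; rewrite !inE /row /col /=.
by move: (nat_of_ord i) (nat_of_ord j) => a b; rewrite /n; split; lia.
Qed.

(** Once the inner positions are correctly filled, only these pieces remain for the outer ones. *)
Definition fresh (t : int * int) (r : 'Z_4) : {set cell n} :=
  [set v : cell n | ~~ [exists u in inner, motion_to t r u v]].

Definition misplaced (t : int * int) (r : 'Z_4) (p v : cell n) (s : 'Z_4) : bool :=
  ~~ ((s == r) && motion_to t r p v).

(** Piece [v], wrongly put at [x.1] with rotation [s], still agrees in colour with the correctly
    placed neighbour [w] across side [x.2]. *)
Definition one_side_match q (g : colouring n q) t r (x : half_edge n) (v : cell n)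
    (s : 'Z_4) : Prop :=
  exists y w, [/\ touch x y, motion_to t r y.1 w, w != v, misplaced t r x.1 v s &
    colour g (v, x.2 - s) = colour g (w, y.2 - r)].

Definition two_sides_match q (g : colouring n q) t r (x : half_edge n) (v : cell n)
    (s : 'Z_4) : Prop :=
  one_side_match g t r x v s /\ one_side_match g t r (x.1, x.2 + 1) v s.

Definition corner_zone c : {set cell n} := setX (near c) (near c).

Lemma corner_zoneE c (u : cell n) : (u \in corner_zone c) =
  ((row u < c)%N || (n <= row u + c)%N) && ((col u < c)%N || (n <= col u + c)%N).
Proof. by case: u => i j; rewrite !inE. Qed.

Section Fill.
Variables (q : nat) (g : colouring n q) (sigma : patch n n) (t : int * int) (r : 'Z_4).
Hypotheses (sigma_inj : pieces_inj sigma) (sigma_valid : valid_patch sigma g).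
Hypothesis inner_right : forall u, u \in inner -> right_place sigma t r u.
Hypothesis no_one_side : forall x v s, x.1 \in corner_zone R.+1 -> v \in fresh t r ->
  ~ one_side_match g t r x v s.
Hypothesis no_two_sides : forall x v s, x.1 \notin inner -> v \in fresh t r ->
  ~ two_sides_match g t r x v s.

Let outer_fresh p : p \notin inner -> (sigma p).1 \in fresh t r.
Proof.
move=> po; rewrite inE; apply/existsP => -[u /andP[ui uv]].
have /andP[_ um] := inner_right ui.
by move: po; rewrite -(sigma_inj (motion_to_inj um uv)) ui.
Qed.

Let wrong_match x y : touch x y -> right_place sigma t r y.1 ->
  ~~ right_place sigma t r x.1 ->
  one_side_match g t r x (sigma x.1).1 (sigma x.1).2.
Proof.
move=> xy /andP[/eqP yr ym] xw; exists y, (sigma y.1).1; split=> //.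
  by apply: contraNneq (touch_cell_neq xy) => /sigma_inj->.
by have := sigma_valid xy; rewrite /occupant yr.
Qed.

Let fill_corner x y : touch x y -> x.1 \in corner_zone R.+1 ->
  right_place sigma t r y.1 -> right_place sigma t r x.1.
Proof.
move=> xy xc yr; have [/inner_right//|xo] := boolP (x.1 \in inner).
apply/negPn/negP => /(wrong_match xy yr); exact/no_one_side/outer_fresh.
Qed.

Let fill_next p d d' y y' : touch (p, d) y -> touch (p, d') y' -> d' = d + 1 ->
  right_place sigma t r y.1 -> right_place sigma t r y'.1 -> right_place sigma t r p.
Proof.
move=> py py' dd yr yr'; have [/inner_right//|po] := boolP (p \in inner).
apply/negPn/negP => pw; apply: (@no_two_sides (p, d) _ (sigma p).2 po (outer_fresh po)).
by rewrite dd in py'; split; [apply: wrong_match py yr pw | apply: wrong_match py' yr' pw].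
Qed.

Let left_top : 2 + 2 = 1 + 2 + 1 :> 'Z_4. Proof. exact: val_inj. Qed.
Let bottom_left : 1 + 2 = 2 + 1 :> 'Z_4. Proof. exact: val_inj. Qed.
Let top_right : 1 = 2 + 2 + 1 :> 'Z_4. Proof. exact: val_inj. Qed.

(** The zone has width [R.+1] because the vertical sweeps start in column [R]. *)
Let corner_at i j : (i <= R)%N \/ (N <= i + R <= N + R)%N ->
  (j <= R)%N \/ (N <= j + R <= N + R)%N -> at_ij N i j \in corner_zone R.+1.
Proof. by move=> iP jP; rewrite !inE /= !inordK /n; lia. Qed.

(** Row by row below the inner square: the first cell of a row has one known neighbour, the others
    have an upper and a left one. *)
Let down_sweep i j : (R <= i <= N)%N -> (R <= j <= N - R)%N ->
  right_place sigma t r (at_ij N i j).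
Proof.
elim: i j => [|i IHi] j iP jP; first by apply/inner_right/inner_at; lia.
have [iR|iR] := leqP i.+1 (N - R); first by apply/inner_right/inner_at; lia.
have up l : (R <= l <= N - R)%N -> touch (at_ij N i.+1 l, 2 + 2) (at_ij N i l, 2).
  by move=> lP; rewrite touch_sym touch_at_below; lia.
elim: j jP => [|j IHj] jP.
  apply: fill_corner (up _ jP) _ (IHi _ _ _); [apply: corner_at; lia | lia | lia].
(* Together with [jP] this is column [R], the start of the row. *)
have [jR|jR] := leqP j.+1 R.
  apply: fill_corner (up _ jP) _ (IHi _ _ _); [apply: corner_at; lia | lia | lia].
have lft : touch (at_ij N i.+1 j.+1, 1 + 2) (at_ij N i.+1 j, 1).
  by rewrite touch_sym touch_at_right; lia.
apply: fill_next lft (up _ jP) left_top (IHj _) (IHi _ _ _); lia.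
Qed.

Let up_sweep e j : (e <= R)%N -> (R <= j <= N - R)%N ->
  right_place sigma t r (at_ij N (R - e) j).
Proof.
elim: e j => [|e IHe] j eR jP; first by apply/inner_right/inner_at; lia.
have down l : (R <= l <= N - R)%N ->
    touch (at_ij N (R - e.+1) l, 2) (at_ij N (R - e) l, 2 + 2).
  by move=> lP; rewrite -(subnSK eR) touch_at_below; lia.
elim: j jP => [|j IHj] jP.
  apply: fill_corner (down _ jP) _ (IHe _ _ _); [apply: corner_at; lia | lia | lia].
have [jR|jR] := leqP j.+1 R.
  apply: fill_corner (down _ jP) _ (IHe _ _ _); [apply: corner_at; lia | lia | lia].
have lft : touch (at_ij N (R - e.+1) j.+1, 1 + 2) (at_ij N (R - e.+1) j, 1).
  by rewrite touch_sym touch_at_right; lia.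
apply: fill_next (down _ jP) lft bottom_left (IHe _ _ _) (IHj _); lia.
Qed.

Let middle i j : (i <= N)%N -> (R <= j <= N - R)%N -> right_place sigma t r (at_ij N i j).
Proof.
move=> iN jP; have [Ri|iR] := leqP R i; first by apply: down_sweep => //; rewrite Ri.
by rewrite -(subKn (ltnW iR)); apply: up_sweep => //; apply: leq_subr.
Qed.

Let right_sweep i j : (i <= N)%N -> (R <= j <= N)%N -> right_place sigma t r (at_ij N i j).
Proof.
elim: j i => [|j IHj] i iN jP; first by apply: middle => //; lia.
have [jR|jR] := leqP j.+1 (N - R); first by apply: middle => //; lia.
have lft l : (l <= N)%N -> touch (at_ij N l j.+1, 1 + 2) (at_ij N l j, 1).
  by move=> lN; rewrite touch_sym touch_at_right; lia.
elim: i iN => [|i IHi] iN.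
  apply: fill_corner (lft _ iN) _ (IHj _ _ _); [apply: corner_at; lia | lia | lia].
have up : touch (at_ij N i.+1 j.+1, 2 + 2) (at_ij N i j.+1, 2).
  by rewrite touch_sym touch_at_below; lia.
apply: fill_next (lft _ iN) up left_top (IHj _ _ _) (IHi _); lia.
Qed.

Let left_sweep i e : (i <= N)%N -> (e <= R)%N -> right_place sigma t r (at_ij N i (R - e)).
Proof.
elim: e i => [|e IHe] i iN eR; first by apply: middle => //; lia.
have rgt l : (l <= N)%N -> touch (at_ij N l (R - e.+1), 1) (at_ij N l (R - e), 1 + 2).
  by move=> lN; rewrite -(subnSK eR) touch_at_right; lia.
elim: i iN => [|i IHi] iN.
  apply: fill_corner (rgt _ iN) _ (IHe _ _ _); [apply: corner_at; lia | lia | lia].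
have up : touch (at_ij N i.+1 (R - e.+1), 2 + 2) (at_ij N i (R - e.+1), 2).
  by rewrite touch_sym touch_at_below; lia.
apply: fill_next up (rgt _ iN) top_right (IHi _) (IHe _ _ _); lia.
Qed.

Lemma all_right_place u : right_place sigma t r u.
Proof.
rewrite -(at_row_col u); have := row_lt u; have := col_lt u.
move: (row u) (col u) => i j; rewrite !ltnS => jN iN.
have [Rj|jR] := leqP R j; first by apply: right_sweep => //; rewrite Rj.
by rewrite -(subKn (ltnW jR)); apply: left_sweep => //; apply: leq_subr.
Qed.

End Fill.

(** The motion is read off at [b] and propagated along row [R], then down each column. *)
Lemma inner_right_of_not_bad (sigma : patch n n) (b := at_ij N R R) :
  (forall u d, u \in inner -> ~~ bad sigma (u, d)) ->
  forall u, u \in inner ->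
    right_place sigma (motion_shift b (sigma b).1 (sigma b).2) (sigma b).2 u.
Proof.
move=> nb; have base := right_place_base sigma b.
have step x y : touch x y -> x.1 \in inner -> touch (occupant sigma x) (occupant sigma y).
  case: x => u d xy /(nb _ d); by rewrite (badP _ xy) negbK.
have hor j : (R <= j <= N - R)%N ->
    right_place sigma (motion_shift b (sigma b).1 (sigma b).2) (sigma b).2 (at_ij N R j).
  elim: j => [|j IHj] jP.
    by rewrite (_ : at_ij N R 0 = b) //; congr (at_ij _ _ _); lia.
  have [jR|jR] := leqP j.+1 R; first by have -> : j.+1 = R by lia.
  have jj : touch (at_ij N R j, 1) (at_ij N R j.+1, 1 + 2) by rewrite touch_at_right; lia.
  apply: (right_place_step jj); first by apply: step => //; apply: inner_at; lia.
  by apply: IHj; lia.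
have ver i j : (R <= i <= N - R)%N -> (R <= j <= N - R)%N ->
    right_place sigma (motion_shift b (sigma b).1 (sigma b).2) (sigma b).2 (at_ij N i j).
  move=> + jP; elim: i => [|i IHi] iP; first by rewrite (_ : at_ij N 0 j = at_ij N R j); [apply: hor | congr (at_ij _ _ _); lia].
  have [iR|iR] := leqP i.+1 R; first by have -> : i.+1 = R; [lia | apply: hor].
  have ii : touch (at_ij N i j, 2) (at_ij N i.+1 j, 2 + 2) by rewrite touch_at_below; lia.
  apply: (right_place_step ii); first by apply: step => //; apply: inner_at; lia.
  by apply: IHi; lia.
move=> u /inner_ltP[h1 h2 h3 h4]; rewrite -(at_row_col u).
by apply: ver; apply/andP.
Qed.

(** Opposite corners of the inner square go to cells [N - 2R] apart in both coordinates, so each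
    coordinate of [c] is within [2R] of an end. Thus boundedly many motions are possible. *)
Lemma base_near_corner (c : cell n) (r : 'Z_4) (b := at_ij N R R) :
  (forall u, u \in inner -> exists v : cell n, motion_to (motion_shift b c r) r u v) ->
  c \in corner_zone R.*2.+1.
Proof.
move=> filled; have [|w] := filled (at_ij N (N - R) (N - R)); first by apply: inner_at; lia.
have := row_lt c; have := col_lt c; have := row_lt w; have := col_lt w.
rewrite corner_zoneE.
rewrite /motion_to /motion_shift /motion_row /motion_col /= !row_at ?col_at; [|lia..].
move: (row c) (col c) (row w) (col w) => i j k l.
by elim/side_ind: r {filled}; rewrite /row_step /col_step /= /n; lia.
Qed.

End Border.

(** * Probability of a wrong match near the border *)

Section BorderProbability.
Variables (N R : nat).
Let n := N.+1.

Lemma card_near c : (#|near N c| <= c.*2)%N.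
Proof.
have card_bounded (S : {set 'I_n}) (f : 'I_n -> nat) :
    injective f -> {in S, forall i, (f i < c)%N} -> (#|S| <= c)%N.
  move=> f_inj fS; rewrite cardE -(size_map f) -[leqRHS](size_iota 0).
  apply: uniq_leq_size; first by rewrite map_inj_uniq ?enum_uniq.
  by move=> _ /mapP[i + ->]; rewrite mem_enum mem_iota => /fS.
have -> : near N c = [set i : 'I_n | (i < c)%N] :|: [set i : 'I_n | (n <= i + c)%N].
  by apply/setP => i; rewrite !inE.
rewrite -addnn (leq_trans (leq_card_setU _ _)) // leq_add //.
  by apply: (card_bounded _ (@nat_of_ord n)) => [|i]; [exact: ord_inj | rewrite inE].
apply: (card_bounded _ (fun i : 'I_n => (N - i)%N)) => [i j /= e|i].
  by apply: ord_inj; have := ltn_ord i; have := ltn_ord j; rewrite /n in e *; lia.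
by rewrite inE /=; have := ltn_ord i; rewrite /n; lia.
Qed.

Lemma card_corner_zone c : (#|corner_zone N c| <= c.*2 ^ 2)%N.
Proof. by rewrite cardsX -mulnn leq_mul // card_near. Qed.

Lemma card_inner : (n ^ 2 - 4 * R * n <= #|inner N R|)%N.
Proof.
have := card_near R; have := cardsC (near N R); rewrite cardsX card_ord.
by move: #|near N R| #|~: near N R| => a b; rewrite /n; nia.
Qed.

Lemma card_outer : (#|~: inner N R| <= 4 * R * n)%N.
Proof.
have := card_inner; have := cardsC (inner N R); rewrite card_prod !card_ord /n.
by move: #|inner _ _| #|~: inner _ _| => a b; rewrite -mulnn; lia.
Qed.

Lemma card_fresh t r :
  (forall u, u \in inner N R -> exists v : cell n, motion_to t r u v) ->
  (#|fresh N R t r| <= 4 * R * n)%N.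
Proof.
move=> filled.
pose h u := odflt u [pick v : cell n | motion_to t r u v].
have hP u : u \in inner N R -> motion_to t r u (h u).
  move=> /filled[v uv]; rewrite /h; case: pickP => // /(_ v).
  by rewrite uv.
have inner_le : (#|inner N R| <= #|~: fresh N R t r|)%N.
  rewrite -(card_in_imset (f := h)); last first.
    move=> u v /hP/andP[/eqP u1 /eqP u2] /hP/andP[/eqP v1 /eqP v2] e.
    by apply: (@motion_inj _ t r); rewrite -?u1 -?u2 -?v1 -?v2 e.
  apply/subset_leq_card/subsetP => _ /imsetP[u ui ->].
  by rewrite !inE negbK; apply/existsP; exists u; rewrite ui hP.
have := card_inner; have := cardsC (fresh N R t r); rewrite card_prod !card_ord.
move: inner_le; rewrite /n -mulnn; lia.
Qed.

(** Touching would force [s = r] and make [v] the expected piece; hence a wrong match is a genuine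
    constraint on two original edges. *)
Lemma misplaced_edge_id t r (x y : half_edge n) (v w : cell n) s : touch x y ->
  motion_to t r y.1 w -> w != v -> misplaced t r x.1 v s ->
  edge_id (w, y.2 - r) != edge_id (v, x.2 - s).
Proof.
move=> xy yw wv; apply: contra; rewrite edge_id_eq => /orP[/eqP[wv' _]|tw].
  by rewrite wv' eqxx in wv.
have sr : s = r.
  have := touch_side tw; rewrite /= (touch_side xy) => e.
  by apply/oppr_inj/(addrI x.2); rewrite e addrAC sum_side4.
rewrite sr eqxx /=; rewrite touch_sym in xy; rewrite (motion_to_touch _ xy yw).
by rewrite -{2}sr.
Qed.

Variables (R' : realType) (q : nat).
Hypothesis q_gt0 : (0 < q)%N.

Lemma prob_one_side_match t r x v s :
  prob R' (fun g : colouring n q => one_side_match g t r x v s) <= q%:R^-1.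
Proof.
have [[y [w [xy yw wv mis]]]|none] := pselect (exists y w,
    [/\ touch x y, motion_to t r y.1 w, w != v & misplaced t r x.1 v s]); last first.
  rewrite prob_eq0 ?invr_ge0 // => g [y [w [xy yw wv mis _]]].
  by apply: none; exists y, w.
apply: (@le_trans _ _ (prob R' (fun g : colouring n q => forall p,
    p \in [:: ((w, y.2 - r), (v, x.2 - s))] -> colour g p.1 = colour g p.2))).
  apply: le_prob => g [y' [w' [xy' yw' _ _ e]]] p; rewrite inE => /eqP -> /=.
  have yy : y' = y := touch_inj xy' xy; rewrite yy in yw' e.
  by rewrite e (motion_to_inj yw' yw).
rewrite -[leRHS]expr1; apply: (prob_triangular _ q_gt0 (s := [:: _])).
by rewrite /= andbT (misplaced_edge_id xy yw wv mis).
Qed.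

(* The two constraints could only coincide if the edge of [z'] meets [a] and that
   of [z] meets [a'], which would require [s = r - 1] and [s = r + 1] mod 4. *)
Lemma prob_two_sides_match t r x v s :
  prob R' (fun g : colouring n q => two_sides_match g t r x v s) <= q%:R^-1 ^+ 2.
Proof.
pose x' : half_edge n := (x.1, x.2 + 1).
have [[y [w [y' [w' [[xy yw wv mis] [xy' yw' wv' mis']]]]]]|none] :=
  pselect (exists y w y' w',
    [/\ touch x y, motion_to t r y.1 w, w != v & misplaced t r x.1 v s] /\
    [/\ touch x' y', motion_to t r y'.1 w', w' != v & misplaced t r x'.1 v s]);
  last first.
  rewrite prob_eq0 ?exprn_ge0 ?invr_ge0 // => g [[y [w [xy yw wv mis _]]]].
  by move=> [y' [w' [xy' yw' wv' mis' _]]]; apply: none; exists y, w, y', w'.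
pose a : half_edge n := (v, x.2 - s); pose a' : half_edge n := (v, x'.2 - s).
pose z : half_edge n := (w, y.2 - r); pose z' : half_edge n := (w', y'.2 - r).
have y2 : y.2 = x.2 + 2 := touch_side xy.
have y'2 : y'.2 = x.2 + 1 + 2 := touch_side xy'.
have match_all g : two_sides_match g t r x v s ->
    colour g z = colour g a /\ colour g z' = colour g a'.
  case=> -[y1 [w1 [xy1 yw1 _ _ e]]] [y1' [w1' [xy1' yw1' _ _ e']]].
  have yy : y1 = y := touch_inj xy1 xy; have yy' : y1' = y' := touch_inj xy1' xy'.
  rewrite yy in yw1 e; rewrite yy' in yw1' e'.
  by rewrite /z /z' (motion_to_inj yw yw1) (motion_to_inj yw' yw1') -e -e'.
have za := misplaced_edge_id xy yw wv mis.
have za' := misplaced_edge_id xy' yw' wv' mis'.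
have aa' : edge_id a != edge_id a'.
  by rewrite edge_id_side (can_eq (subrK _)) -subr_eq0 opprD addNKr.
have zz' : edge_id z != edge_id z'.
  rewrite edge_id_eq negb_or; apply/andP; split.
    apply/eqP => /(congr1 snd) /=; rewrite y2 y'2 => /addIr/eqP; apply/negP.
    by elim/side_ind: (x.2).
  apply/negP => /touch_side /=; rewrite y2 y'2 => /eqP; apply/negP.
  by elim/side_ind: (x.2); elim/side_ind: (r).
have side_of b c : edge_id b == edge_id c -> b.1 != c.1 -> c.2 = b.2 + 2.
  rewrite edge_id_eq => /orP[/eqP->|/touch_side//].
  by rewrite eqxx.
have [z'a|z'a] := eqVneq (edge_id z') (edge_id a).
  have za'' : edge_id z != edge_id a'.
    apply/negP => /side_of /= /(_ wv); rewrite y2 => e1.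
    move/eqP: z'a => /side_of /= /(_ wv'); rewrite y'2 => e2.
    have : x.2 + 1 - s - (x.2 - s) = x.2 + 2 - r + 2 - (x.2 + 1 + 2 - r + 2).
      by rewrite -e1 -e2.
    by move/eqP; apply/negP; elim/side_ind: (x.2); elim/side_ind: (r); elim/side_ind: (s).
  apply: le_trans (_ : prob R' (fun g : colouring n q => forall p,
    p \in [:: (z, a); (z', a')] -> colour g p.1 = colour g p.2) <= _).
    by apply: le_prob => g /match_all[e e'] p; rewrite !inE => /orP[]/eqP->.
  apply: (prob_triangular _ q_gt0 (s := [:: _; _])).
  by rewrite /= !inE za zz' za'' za'.
apply: le_trans (_ : prob R' (fun g : colouring n q => forall p,
  p \in [:: (z', a'); (z, a)] -> colour g p.1 = colour g p.2) <= _).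
  by apply: le_prob => g /match_all[e e'] p; rewrite !inE => /orP[]/eqP->.
apply: (prob_triangular _ q_gt0 (s := [:: _; _])).
by rewrite /= !inE za' (eq_sym (edge_id z')) zz' z'a za.
Qed.

Definition border_match (g : colouring n q) t r : Prop :=
  (exists x v s, [/\ x.1 \in corner_zone N R.+1, v \in fresh N R t r &
     one_side_match g t r x v s]) \/
  (exists x v s, [/\ x.1 \notin inner N R, v \in fresh N R t r &
     two_sides_match g t r x v s]).

(** Coefficients of [n / q] and of [(n / q)^2] in the two union bounds. *)
Definition border_const : nat := ((R.+1).*2 ^ 2 * 4 * (4 * R) * 4 + (16 * R) * (16 * R))%N.

Lemma prob_border_match (alpha : R') t r : 0 <= alpha <= 1 -> n%:R * q%:R^-1 <= alpha ->
  (forall u, u \in inner N R -> exists v : cell n, motion_to t r u v) ->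
  prob R' (fun g => border_match g t r) <= border_const%:R * alpha.
Proof.
move=> /andP[a_ge0 a_le1] nq filled.
have q1 : 0 <= q%:R^-1 :> R' by rewrite invr_ge0.
have nq0 : 0 <= n%:R * q%:R^-1 :> R' by rewrite mulr_ge0.
have union (U : {set cell n}) (E : colouring n q -> half_edge n -> cell n -> 'Z_4 -> Prop)
    (b : R') (c : nat) : 0 <= b ->
    (#|U| <= c)%N -> (forall x v s, prob R' (fun g => E g x v s) <= b) ->
    prob R' (fun g => exists x v s, [/\ x.1 \in U, v \in fresh N R t r & E g x v s])
      <= (c * 4 * (4 * R * n) * 4)%:R * b.
  move=> b_ge0 Uc Eb.
  pose S := setX (setX (setX U [set: 'Z_4]) (fresh N R t r)) [set: 'Z_4].
  apply: (@le_trans _ _ (prob R' (fun g => exists2 i, i \in S &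
      E g i.1.1 i.1.2 i.2))).
    apply: le_prob => g [x [v [s [xU vf e]]]]; exists (x, v, s) => //.
    by case: x xU {e} => p d /= pU; rewrite /S !in_setX pU vf !inE.
  apply: le_trans (prob_exists _ _ _) _.
  apply: (@le_trans _ _ (\sum_(i in S) b)); first by apply: ler_sum.
  rewrite sumr_const -[leLHS]mulr_natl ler_wpM2r // ler_nat.
  by rewrite !cardsX !cardsT card_ord !leq_mul // card_fresh.
apply: le_trans (prob_or _ _ _) _.
rewrite /border_const natrD mulrDl lerD //.
  apply: le_trans (union _ _ _ _ q1 (card_corner_zone _) _) _.
    exact: prob_one_side_match.
  rewrite (_ : (_ * (4 * R * n) * 4)%N = (R.+1.*2 ^ 2 * 4 * (4 * R) * 4 * n)%N); last by lia.
  by rewrite natrM -mulrA ler_wpM2l.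
apply: le_trans (_ : (4 * R * n * 4 * (4 * R * n) * 4)%:R * q%:R^-1 ^+ 2 <= _).
  apply: le_trans (union (~: inner N R) (fun g => two_sides_match g t r)
    (q%:R^-1 ^+ 2) _ _ card_outer (prob_two_sides_match t r)); last by rewrite exprn_ge0.
  apply: le_prob => g [x [v [s [xo vf e]]]]; exists x, v, s; split=> //.
  by rewrite in_setC.
rewrite (_ : (_ * (4 * R * n) * 4)%N = (16 * R * (16 * R) * n ^ 2)%N); last by lia.
rewrite natrM natrX -mulrA -exprMn ler_wpM2l //.
apply: (le_trans _ nq); rewrite expr2 ler_piMr //.
exact: le_trans nq a_le1.
Qed.
End BorderProbability.

(** * From reconstructions to patches *)

Section Reduction.
Variables (N m : nat).
Let n := N.+1.
Let R := (radius m).*2.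
Hypothesis RN : (R + R <= N)%N.

Definition placement k (H : reconstruction k) : patch k k :=
  [ffun p => ((position H)^-1%g p, rotation H ((position H)^-1%g p))].

Lemma place_occupant k (H : reconstruction k) x : place H (occupant (placement H) x) = x.
Proof. by case: x => p d; rewrite /place /occupant /= !ffunE /= permKV subrK. Qed.

Lemma occupant_place k (H : reconstruction k) h : occupant (placement H) (place H h) = h.
Proof. by case: h => v d; rewrite /place /occupant /= !ffunE /= permK addrK. Qed.

Lemma placement_inj k (H : reconstruction k) : pieces_inj (placement H).
Proof. by move=> u v; rewrite !ffunE => /perm_inj. Qed.

Lemma placement_valid k q (g : colouring k q) (H : reconstruction k) :
  valid g H -> valid_patch (placement H) g.
Proof.
move=> Hg x y xy; apply: (Hg _ (edge_of_edges H (occupant (placement H) x))).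
  by rewrite inE eqxx.
by rewrite inE !place_occupant xy orbT.
Qed.

(** Touching pairs of [H] also touch originally, and [place H] shows that there are equally many, so
    both touching relations coincide. *)
Lemma edges_of_not_bad k (H : reconstruction k) :
  (forall x, ~~ bad (placement H) x) -> edges H = edges (original k).
Proof.
move=> nb.
have good h h' : touch (place H h) (place H h') -> touch h h'.
  by move=> hh'; have := nb (place H h); rewrite (badP _ hh') negbK !occupant_place.
pose TH := [set p : half_edge k * half_edge k | touch (place H p.1) (place H p.2)].
pose TG := [set p : half_edge k * half_edge k | touch p.1 p.2].
have TH_TG : TH = TG.
  apply/eqP; rewrite eqEcard; apply/andP; split.
    by apply/subsetP => p; rewrite !inE; apply: good.
  pose pl (p : half_edge k * half_edge k) := (place H p.1, place H p.2).
  apply: leq_trans (leq_imset_card pl (mem TH)).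
  apply/subset_leq_card/subsetP => -[x y]; rewrite inE => xy.
  apply/imsetP; exists (occupant (placement H) x, occupant (placement H) y).
    by rewrite inE !place_occupant.
  by rewrite /pl !place_occupant.
apply: eq_imset => h; apply/setP => h'; rewrite !inE !place_original.
by have /setP/(_ (h, h')) := TH_TG; rewrite !inE => ->.
Qed.

Lemma inner_not_bad q (g : colouring n q) (sigma : patch n n) :
  pieces_inj sigma -> valid_patch sigma g ->
  (forall r (tau : patch r.*2.+1 n), (r <= R)%N ->
     pieces_inj tau -> valid_patch tau g -> sparse m tau) ->
  forall u d, u \in inner N R -> ~~ bad sigma (u, d).
Proof.
move=> s_inj sg sp u d /inner_ltP[//|h1 h2 h3 h4].
have aN : (row u - R + R.*2.+1 <= N.+1)%N by lia.
have bN : (col u - R + R.*2.+1 <= N.+1)%N by lia.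
pose tau := window R.*2.+1 (row u - R) (col u - R) sigma.
have nb := @centre_not_bad n q g m tau d (window_inj aN bN s_inj)
  (window_valid aN bN sg) sp.
have Rb : ~~ on_boundary (at_ij R.*2 R R).
  have R_gt0 : (0 < R)%N by rewrite double_gt0.
  by rewrite /on_boundary row_at ?col_at //; lia.
have /existsP[y cy] := @interior_has_mate _ (at_ij R.*2 R R, d) Rb.
move: nb; rewrite (bad_window sigma aN bN cy).
rewrite (_ : shift_half _ _ _ _ = (u, d)) //; congr (_, _).
by apply: cell_eq; rewrite /= ?row_shift ?col_shift ?row_at ?col_at //; lia.
Qed.

Definition filled (c : cell n) (r : 'Z_4) : Prop := forall u, u \in inner N R ->
  exists v : cell n, motion_to (motion_shift (at_ij N R R) c r) r u v.

(** The motion is fixed by the piece at [(R, R)] and its rotation, so the second case is a union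
    over boundedly many events not mentioning [H]. *)
Lemma not_unique_cases q (g : colouring n q) : ~ unique_reconstruction g ->
  (exists2 r : 'I_R.+1, true & exists tau : patch r.*2.+1 n,
     [/\ pieces_inj tau, valid_patch tau g & ~ sparse m tau]) \/
  (exists2 p : cell n * 'Z_4, (p.1 \in corner_zone N R.*2.+1) && `[< filled p.1 p.2 >] &
     border_match R g (motion_shift (at_ij N R R) p.1 p.2) p.2).
Proof.
apply: contra_notP => /not_orP[all_sparse no_border] H Hg.
apply: edges_of_not_bad.
have s_inj := @placement_inj _ H; have sg := placement_valid Hg.
set sigma := placement H in s_inj sg *; pose b := at_ij N R R.
have sp r (tau : patch r.*2.+1 n) : (r <= R)%N ->
    pieces_inj tau -> valid_patch tau g -> sparse m tau.
  move=> rR t_inj tg; apply: contrapT => ns; apply: all_sparse.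
  by exists (Ordinal (rR : (r < R.+1)%N)) => //; exists tau.
have inner_right := inner_right_of_not_bad RN (inner_not_bad s_inj sg sp).
have fill : filled (sigma b).1 (sigma b).2.
  by move=> u /inner_right/andP[_ um]; exists (sigma u).1.
have zone := base_near_corner RN fill.
have nb : ~ border_match R g (motion_shift b (sigma b).1 (sigma b).2) (sigma b).2.
  move=> bm; apply: no_border; exists (sigma b) => //.
  by rewrite zone; apply/asboolP.
have all_right u : right_place sigma (motion_shift b (sigma b).1 (sigma b).2) (sigma b).2 u.
  apply: (all_right_place RN s_inj sg inner_right) => x v s xP vf match_v; apply: nb.
    by left; exists x, v, s.
  by right; exists x, v, s.
move=> x; apply/negP => /existsP[y /andP[xy /negP]]; apply.
exact: right_place_touch xy (all_right _) (all_right _).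
Qed.

Definition total_const : nat :=
  (\sum_(r < R.+1) patch_const r.*2.+1 + R.*2.+1.*2 ^ 2 * 4 * border_const R)%N.

Lemma prob_unique_ge (K : realType) q (alpha : K) : (0 < q)%N ->
  0 <= alpha <= 1 -> n%:R^-1 = alpha ^+ m -> q%:R^-1 <= alpha ^+ m.+1 ->
  1 - total_const%:R * alpha <= prob K (@unique_reconstruction n q).
Proof.
move=> q_gt0 a01 n_alpha q_alpha; have /andP[a_ge0 a_le1] := a01.
rewrite (prob_setC _ q_gt0) lerD2l lerN2.
apply: le_trans (le_prob _ (@not_unique_cases q)) _.
apply: le_trans (prob_or _ _ _) _.
rewrite /total_const natrD mulrDl lerD //.
  apply: le_trans (prob_exists _ _ _) _.
  rewrite natr_sum mulr_suml; apply: ler_sum => r _.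
  by rewrite mulrC; apply: prob_not_sparse.
apply: le_trans (prob_exists _ _ _) _.
have nq : n%:R * q%:R^-1 <= alpha.
  rewrite mulrC -ler_pdivlMr ?ltr0n //.
  by rewrite n_alpha -exprS in q_alpha *.
apply: (@le_trans _ _ (\sum_(p in setX (corner_zone N R.*2.+1) [set: 'Z_4])
    (border_const R)%:R * alpha)).
  rewrite big_mkcond [leRHS]big_mkcond; apply: ler_sum => -[c r] _.
  rewrite in_setX in_setT andbT /=; case: (c \in _) => //=.
  case: asboolP => [fp|_]; last by rewrite mulr_ge0.
  exact: prob_border_match.
rewrite sumr_const -[leLHS]mulr_natl mulrA -natrM ler_wpM2r // ler_nat.
rewrite leq_mul2r cardsX cardsT card_ord leq_mul2r card_corner_zone !orbT //.
Qed.

End Reduction.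

(** * Asymptotics for both regimes *)

Local Open Scope classical_set_scope.
Local Open Scope ring_scope.

Theorem theorem1 (R : realType) (eps : R) (q : nat -> nat)
    (eps_gt0 : 0 < eps) (q_gt0 : forall n : nat, (0 < q n)%N) :
  ((fun n : nat => (q n)%:R : R) =o_\oo (fun n : nat => n%:R : R) ->
    prob R (@unique_reconstruction n (q n)) @[n --> \oo] --> (0 : R))
  /\
  ((\forall n \near \oo, (n%:R : R) `^ (1 + eps) <= (q n)%:R) ->
    prob R (@unique_reconstruction n (q n)) @[n --> \oo] --> (1 : R)).
Proof.
split=> [q_small|q_large]; apply/cvgrPdist_lt => e e_gt0.
  (* Both [d < 1] and [d < e], so [q / n <= d] gives [(q / n)^2 <= d < e]. *)
  pose d : R := e / (1 + e).
  have d_gt0 : 0 < d by rewrite divr_gt0 // addr_gt0.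
  have d_lt1 : d < 1 by rewrite ltr_pdivrMr ?addr_gt0 // mul1r ltrDr.
  have d_lte : d < e by rewrite ltr_pdivrMr ?addr_gt0 // mulrDr mulr1 ltrDl mulr_gt0.
  have /eqoP/(_ _ d_gt0) small_q := q_small.
  near=> n.
  have n_gt1 : (1 < n)%N by near: n; exact: nbhs_infty_gt.
  have n_gt0 : 0 < n%:R :> R by rewrite ltr0n ltnW.
  rewrite sub0r normrN ger0_norm ?prob_ge0 //.
  apply: le_lt_trans d_lte; apply: le_trans (prob_unique_le _ (q_gt0 n) n_gt1) _.
  have qn : (q n)%:R / n%:R <= d.
    rewrite ler_pdivrMr //.
    have : `|(q n)%:R : R| <= d * `|n%:R : R| by near: n.
    by rewrite !ger0_norm.
  apply: (le_trans _ qn); rewrite expr2 ler_piMr ?divr_ge0 //.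
  exact: le_trans qn (ltW d_lt1).
(* Ensures [m^-1 <= eps], so that [q^-1 <= n^-(1+eps) <= alpha^(m+1)] for [alpha = n^(-1/m)]. *)
pose m := (Num.truncn eps^-1).+1.
have m_gt0 : 0 < m%:R :> R by rewrite ltr0n.
have m_eps : m%:R^-1 <= eps.
  rewrite -[leRHS]invrK lef_pV2 ?posrE ?invr_gt0 // ltW //.
  by rewrite -truncn_lt_nat ?invr_ge0 ?(ltW eps_gt0).
pose C := total_const m.
have unique_ge n alpha : ((radius m).*2 + (radius m).*2 < n)%N -> 0 <= alpha <= 1 ->
    n%:R^-1 = alpha ^+ m -> (q n)%:R^-1 <= alpha ^+ m.+1 ->
    1 - C%:R * alpha <= prob R (@unique_reconstruction n (q n)).
  by case: n => // N n_large; apply: prob_unique_ge.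
(* The successor avoids a zero denominator; [alpha < d] gives [C * alpha < e]. *)
pose d : R := e / C.+1%:R.
have d_gt0 : 0 < d by rewrite divr_gt0 // ltr0n.
near=> n.
have n_large : ((radius m).*2 + (radius m).*2 < n)%N by near: n; exact: nbhs_infty_gt.
(* As [alpha^m = n^-1], this is the threshold for [alpha < d]. *)
have n_d : (d ^+ m)^-1 < n%:R by near: n; exact: nbhs_infty_gtr.
have n_q : n%:R `^ (1 + eps) <= (q n)%:R by near: n.
have n_gt0 : (0 < n)%N by apply: leq_ltn_trans n_large.
have n_ge1 : 1 <= n%:R :> R by rewrite ler1n.
pose alpha : R := n%:R `^ (- m%:R^-1).
have a_ge0 : 0 <= alpha by rewrite powR_ge0.
have a_le1 : alpha <= 1.
  by rewrite -[leRHS](powRr0 n%:R); apply: ler_powR.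
have a_pow : n%:R^-1 = alpha ^+ m.
  by rewrite -powR_mulrn // -powRrM mulNr mulVf ?gt_eqF // powR_inv1.
have q_pow : (q n)%:R^-1 <= alpha ^+ m.+1.
  rewrite -powR_mulrn // -powRrM.
  apply: (@le_trans _ _ (n%:R `^ (- (1 + eps)))).
    by rewrite powRN lef_pV2 ?posrE ?powR_gt0 ?ltr0n.
  apply: ler_powR => //; rewrite mulNr lerN2 -natr1 mulrDr mulr1 mulVf ?gt_eqF //.
  by rewrite lerD2l.
have a_lt : alpha < d.
  rewrite ltNge; apply/negP => d_le; move: n_d; apply/negP; rewrite -leNgt.
  rewrite -[leLHS]invrK lef_pV2 ?posrE ?exprn_gt0 ?invr_gt0 ?ltr0n //.
  by rewrite a_pow lerXn2r ?nnegrE // ltW.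
have P_le1 := prob_le1 R (q_gt0 n) (@unique_reconstruction n (q n)).
rewrite ger0_norm ?subr_ge0 // ltrBlDr -ltrBlDl.
apply: lt_le_trans (unique_ge _ _ n_large _ a_pow q_pow); last by rewrite a_ge0.
rewrite ltrD2l ltrN2; apply: (@le_lt_trans _ _ (C.+1%:R * alpha)).
  by rewrite ler_wpM2r // ler_nat.
by rewrite mulrC -ltr_pdivlMr ?ltr0n.
Unshelve. all: by end_near.
Qed.
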